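(* There is a covariant functor $\mathsf{E}\colon\mathsf{QPMet}\to\mathsf{Sets}$, where $\mathsf{E}(X,C)$ is the set of filtered ends of $(X,C)$, with the following properties: (1) If $f\colon(X,C)\to(X,C)$ is a morphism such that $f$ is at distance at most $r$ from the identity function on $X$ (for some $r\ge 0$), then $\mathsf{E}(f)$ is the identity morphism of $\mathsf{E}(X,C)$. (2) If $f\colon X\to Y$ is a quasi-isometry, $C\subseteq X$ and $D\subseteq Y$, and the Hausdorff distance $\mathsf{hdist}(f(C),D)$ is finite, then $\mathsf{E}(f)\colon\mathsf{E}(X,C)\to\mathsf{E}(Y,D)$ is a bijection. (3) If $X$ is a proper geodesic metric space and $C\subseteq X$ is compact, then there is a natural bijection $\mathsf{E}(X,C)\to\mathsf{Ends}(X)$, where $\mathsf{Ends}(X)$ is the usual set of ends of $X$. (4) If $X$ is the Cayley graph with the combinatorial path metric of a finitely generated group $G$ and $P\le G$, then the cardinality of $\mathsf{E}(X,P)$ coincides with the number of coends of $(G,P)$ in the sense of Bowditch.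
   Context: For a subset $C$ of a metric space and $r\ge0$, $C^{+r}$ is the open $r$-neighborhood of $C$. A map $f\colon X\to Y$ is a quasi-isometry if there are $\lambda\ge1$, $\epsilon\ge0$ and $\bar f\colon Y\to X$ such that $f,\bar f$ are $(\lambda,\epsilon)$-coarse Lipschitz ($\mathsf{dist}(f(x),f(x'))\le\lambda\,\mathsf{dist}(x,x')+\epsilon$, similarly for $\bar f$) and $\bar f f$, $f\bar f$ are at distance at most $\epsilon$ from the identities. A map $f\colon X\to Y$ is a quasi-isometric map if $f\colon X\to f(X)$ is a quasi-isometry; equivalently, for some $\lambda\ge1,\epsilon\ge0$, $\frac1\lambda\mathsf{dist}(x,x')-\epsilon\le\mathsf{dist}(f(x),f(x'))\le\lambda\,\mathsf{dist}(x,x')+\epsilon$ for all $x,x'$. $\mathsf{QPMet}$ is the category whose objects are pairs $(X,C)$ with $X$ a metric space and $C$ a non-empty subspace; morphisms $(X,C)\to(Y,D)$ are quasi-isometric maps $f\colon X\to Y$ such that $D\subseteq f(C)^{+r}$ for some $r\ge0$; composition is composition of functions. All pairs in the statement are objects of $\mathsf{QPMet}$ (so $C$, $D$ are non-empty). Filtered ends. A subset $A$ of a metric space is $\sigma$-coarsely connected if any two points of $A$ are joined by a finite sequence of points of $A$ with consecutive distances $\le\sigma$. $\mathcal{C}_\infty(Z,\sigma)$ is the set of unbounded $\sigma$-coarsely connected components of $Z$. For $\mu\le\mu'$ there is a map $\mathcal{C}_\infty(X-C^{+\mu'},\sigma)\to\mathcal{C}_\infty(X-C^{+\mu},\sigma)$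 sending a component to the one containing it; $\mathsf{E}(X,C,\sigma)=\varprojlim_{\mu}\mathcal{C}_\infty(X-C^{+\mu},\sigma)$. For $\sigma\le\sigma'$, sending components to the $\sigma'$-components containing them induces $\varphi_{\sigma,\sigma'}\colon\mathsf{E}(X,C,\sigma)\to\mathsf{E}(X,C,\sigma')$, and $\mathsf{E}(X,C)=\varinjlim_\sigma\mathsf{E}(X,C,\sigma)$. For a morphism $f\colon(X,C)\to(Y,D)$ of $\mathsf{QPMet}$, choose $\lambda\ge1$, $\epsilon\ge0$ with $\frac1\lambda\mathsf{dist}(x,x')-\epsilon\le\mathsf{dist}(f(x),f(x'))\le\lambda\,\mathsf{dist}(x,x')+\epsilon$ for all $x,x'\in X$, and $r\ge0$ with $D\subseteq f(C)^{+r}$; then $\mathsf{E}(f)$ is induced, by taking inverse limits over $\mu$ and then direct limits over $\sigma$, by the maps $\mathcal{C}_\infty(X-C^{+\mu},\sigma)\to\mathcal{C}_\infty(Y-D^{+(\mu/\lambda-\epsilon-r)},\lambda\sigma+\epsilon)$, for $\sigma>0$, $\mu\ge\lambda(\epsilon+r)$, sending $A$ to the unique component containing $f(A)$. Ends. $\mathsf{Ends}(X)$ (Bridson–Haefliger) is the set of equivalence classes of proper continuous rays $r\colon[0,\infty)\to X$, where $r_1\sim r_2$ if for every compact $K\subseteq X$ there is $N$ such that $r_1([N,\infty))$ and $r_2([N,\infty))$ lie in the same path component of $X-K$. Coends. Let $X$ be a Cayley graph of $G$ with respect to a finite generating set and $P\le G$. Let $\mathscr{S}_0(P)$ be the collection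 of non-empty connected $P$-invariant subgraphs of $X$ with compact quotient under $P$. For $A\in\mathscr{S}_0(P)$ let $\mathscr{C}_\infty(A)$ be the set of components of $X-A$ that are not contained in any other element of $\mathscr{S}_0(P)$. If $A\subseteq B$ are in $\mathscr{S}_0(P)$ there is a surjective map $\mathscr{C}_\infty(B)\to\mathscr{C}_\infty(A)$ (sending a component to the one containing it). The number of coends of $(G,P)$ is the cardinality of the inverse limit of $(\mathscr{C}_\infty(A): A\in\mathscr{S}_0(P))$.
   Formalization: Part (4) is stated only when the collection S_0(P) is non-empty (equivalently P is finitely generated); otherwise the number of coends is an empty inverse limit and the claim fails, e.g. for G = F_2 and P = [F_2,F_2]. *)

(* Defs.v *)
From HB Require Import structures.
From mathcomp Require Import all_boot all_order all_algebra.
From mathcomp Require Import interval_inference generic_quotient.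
From mathcomp Require Import boolp classical_sets functions cardinality.
From mathcomp Require Import ring set_interval reals ereal topology.

Set Implicit Arguments.
Unset Strict Implicit.
Unset Printing Implicit Defensive.

Import Order.TTheory GRing.Theory Num.Theory.
Import numFieldTopology.Exports.

Local Open Scope classical_set_scope.
Local Open Scope ring_scope.

Definition inv_limit (I : Type) (le : I -> I -> Prop) (T : I -> Type)
    (pi : forall i j, le i j -> T j -> T i) : Type :=
  {x : forall i, T i | forall i j (ij : le i j), pi i j ij (x j) = x i}.

(* The set of classes of an equivalence relation; the class of x is the set
   of the y such that e x y. *)
Definition classes (T : Type) (e : T -> T -> Prop) : Type :=
  {c : set T | exists x, c = [set y | e x y]}.

Definition class_of (T : Type) (e : T -> T -> Prop) (x : T) : classes e :=
  exist _ [set y | e x y] (ex_intro _ x erefl).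

Definition germ_eq (I : Type) (le : I -> I -> Prop) (T : I -> Type)
    (phi : forall i j, le i j -> T i -> T j) (x y : {i : I & T i}) : Prop :=
  exists (k : I) (xk : le (tag x) k) (yk : le (tag y) k),
    phi _ _ xk (tagged x) = phi _ _ yk (tagged y).

Definition dir_limit (I : Type) (le : I -> I -> Prop) (T : I -> Type)
    (phi : forall i j, le i j -> T i -> T j) : Type := classes (germ_eq phi).

Definition dir_inj (I : Type) (le : I -> I -> Prop) (T : I -> Type)
    (phi : forall i j, le i j -> T i -> T j) (i : I) (x : T i) :
  dir_limit phi := class_of (germ_eq phi) (existT T i x).

Section MetricNotions.
Context {R : realType}.

Definition thicken {X : metricType R} (C : set X) (r : R) : set X :=
  [set x | exists2 c, C c & mdist c x < r].

Definition bounded {X : metricType R} (A : set X) : Prop :=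
  exists M : R, forall x y, A x -> A y -> mdist x y <= M.

Definition hdist {X : metricType R} (A B : set X) : \bar R :=
  ereal_inf [set r%:E | r in
    [set r : R | [/\ 0 <= r, A `<=` thicken B r & B `<=` thicken A r]]].

Definition coarse_lipschitz {X Y : metricType R} (lam eps : R) (f : X -> Y) :=
  forall x x', mdist (f x) (f x') <= lam * mdist x x' + eps.

Definition quasi_isometry {X Y : metricType R} (f : X -> Y) : Prop :=
  exists (lam eps : R) (g : Y -> X),
    [/\ 1 <= lam, 0 <= eps, coarse_lipschitz lam eps f,
        coarse_lipschitz lam eps g &
        (forall x, mdist (g (f x)) x <= eps) /\
        (forall y, mdist (f (g y)) y <= eps)].

Definition qi_bounds {X Y : metricType R} (lam eps : R) (f : X -> Y) : Prop :=
  [/\ 1 <= lam, 0 <= eps & forall x x',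
      lam^-1 * mdist x x' - eps <= mdist (f x) (f x') <=
      lam * mdist x x' + eps].

Definition quasi_isometric {X Y : metricType R} (f : X -> Y) : Prop :=
  exists lam eps : R, qi_bounds lam eps f.

Definition proper_space (X : metricType R) : Prop :=
  forall (x : X) (r : R), compact [set y : X | mdist x y <= r].

Definition geodesic_space (X : metricType R) : Prop :=
  forall x y : X, exists gamma : R -> X,
    [/\ gamma 0 = x, gamma (mdist x y) = y &
        forall s t, 0 <= s <= mdist x y -> 0 <= t <= mdist x y ->
          mdist (gamma s) (gamma t) = `|s - t|].

End MetricNotions.

Section QPMet.
Context (R : realType).

Record qpmet : Type := QPMet {
  space :> metricType R;
  base : set space;
  base_nonempty : base !=set0 }.

Arguments base : clear implicits.

Definition qp_morphism (X Y : qpmet) (f : X -> Y) : Prop :=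
  quasi_isometric f /\
  exists2 r : R, 0 <= r & base Y `<=` thicken (f @` base X) r.

Record qpmor (X Y : qpmet) : Type := QPMor {
  qpfun :> X -> Y;
  qpmorP : qp_morphism qpfun }.

Lemma qp_morphism_id (X : qpmet) : qp_morphism (fun x : X => x).
Proof.
split.
  exists 1, 0; split=> // x x'.
  by rewrite invr1 !mul1r subr0 addr0 lexx.
by exists 1 => // c Cc; exists c; [exists c|rewrite mdistxx].
Qed.

Lemma qp_morphism_comp (X Y Z : qpmet) (g : qpmor Y Z) (f : qpmor X Y) :
  qp_morphism (fun x => g (f x)).
Proof.
case: g f => [g [[l2 [e2 [l2_ge1 e2_ge0 g_qi]]] [r2 r2_ge0 Dg]]].
move=> [f [[l1 [e1 [l1_ge1 e1_ge0 f_qi]]] [r1 r1_ge0 Df]]] /=.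
have l1_gt0 : 0 < l1 by apply: lt_le_trans l1_ge1.
have l2_gt0 : 0 < l2 by apply: lt_le_trans l2_ge1.
split.
  exists (l2 * l1), (l2 * e1 + e2); split.
  - by rewrite -[leLHS]mulr1 ler_pM.
  - by rewrite addr_ge0// mulr_ge0// ltW.
  - move=> x x'; have /andP[f_lo f_up] := f_qi x x'.
    have /andP[g_lo g_up] := g_qi (f x) (f x').
    apply/andP; split.
      apply: le_trans g_lo; rewrite opprD addrA lerB//.
      rewrite invfM -mulrA.
      have: l2^-1 * (l1^-1 * mdist x x' - e1) <= l2^-1 * mdist (f x) (f x').
        by rewrite ler_wpM2l// invr_ge0 ltW.
      apply: le_trans; rewrite mulrBr; apply: lerB => //; apply: ler_wpM2r => //.
      by apply: le_trans (l2_ge1); rewrite invf_le1.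
    apply: (le_trans g_up); rewrite addrA lerD2r -mulrA -mulrDr.
    by rewrite ler_wpM2l// ltW.
exists (l2 * r1 + e2 + r2).
  by rewrite !addr_ge0// mulr_ge0// ltW.
move=> z /Dg[_ [y Dy <-] gyz]; have [_ [x Cx <-] fxy] := Df _ Dy.
exists (g (f x)); first by exists x.
apply: (le_lt_trans (metric_triangle _ (g y) _)).
rewrite ler_ltD//; have /andP[_ /le_trans->//] := g_qi (f x) y.
by rewrite lerD2r ler_wpM2l// ltW.
Qed.

Definition qpid (X : qpmet) : qpmor X X := QPMor (qp_morphism_id X).

Definition qpcomp (X Y Z : qpmet) (g : qpmor Y Z) (f : qpmor X Y) :
  qpmor X Z := QPMor (qp_morphism_comp g f).

End QPMet.

Arguments base {R} q.

Section CoarseComponents.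
Context {R : realType} {X : metricType R}.
Implicit Types (Z A : set X) (s : R).

Definition coarse_joined Z s (x y : X) : Prop :=
  exists p : seq X, [/\ path (fun a b => mdist a b <= s) x p, last x p = y &
    forall z, z \in x :: p -> Z z].

Definition coarse_component Z s (x : X) : set X :=
  [set y | coarse_joined Z s x y].

Definition unbounded_component Z s A : Prop :=
  (exists2 x, Z x & A = coarse_component Z s x) /\ ~ bounded A.

Definition Cinfty Z s : Type := {A : set X | unbounded_component Z s A}.

(* The s-coarse component of Z containing A, when A lies in one. *)
Definition coarse_hull Z s A : set X :=
  [set y | exists2 x, A x & coarse_joined Z s x y].

Lemma coarse_joined_refl Z s x : Z x -> coarse_joined Z s x x.
Proof. by move=> Zx; exists [::]; split=> // z; rewrite inE => /eqP->. Qed.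

Lemma coarse_joined_mem Z s x y : coarse_joined Z s x y -> Z x /\ Z y.
Proof.
by move=> [p [_ <- Zp]]; split; apply: Zp; rewrite ?mem_head// mem_last.
Qed.

Lemma coarse_joined_trans Z s x y z :
  coarse_joined Z s x y -> coarse_joined Z s y z -> coarse_joined Z s x z.
Proof.
move=> [p [xp py Zp]] [q [yq qz Zq]]; exists (p ++ q); split.
- by rewrite cat_path xp py.
- by rewrite last_cat py.
- move=> w; rewrite -cat_cons mem_cat => /orP[/Zp//|wq].
  by apply: Zq; rewrite inE wq orbT.
Qed.

Lemma coarse_joined_sub Z' Z s' s x y : Z' `<=` Z -> s' <= s ->
  coarse_joined Z' s' x y -> coarse_joined Z s x y.
Proof.
move=> ZZ ss [p [xp py Zp]]; exists p; split=> //; last by move=> z /Zp/ZZ.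
by apply: sub_path xp => a b /le_trans; apply.
Qed.

Lemma coarse_hull_component Z' Z s' s A : Z' `<=` Z -> s' <= s ->
  unbounded_component Z' s' A -> unbounded_component Z s (coarse_hull Z s A).
Proof.
move=> ZZ ss [[x Zx ->] Abd]; split.
  exists x; first exact: ZZ.
  apply/seteqP; split=> y.
    move=> [z /(coarse_joined_sub ZZ ss) xz]; exact: coarse_joined_trans.
  by exists x => //; apply: coarse_joined_refl.
apply: contra_not Abd => -[M AM]; exists M => y z xy xz.
apply: AM; [exists y | exists z] => //; apply: coarse_joined_refl; apply: ZZ.
  exact: (coarse_joined_mem xy).2.
exact: (coarse_joined_mem xz).2.
Qed.

Lemma coarse_hull_hull Z' Z s' s A : Z' `<=` Z -> s' <= s -> A `<=` Z' ->
  coarse_hull Z s (coarse_hull Z' s' A) = coarse_hull Z s A.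
Proof.
move=> ZZ ss AZ; apply/seteqP; split=> y.
  move=> [z [x Ax /(coarse_joined_sub ZZ ss) xz] zy].
  by exists x => //; apply: coarse_joined_trans zy.
move=> [x Ax xy]; exists x => //; exists x => //.
by apply: coarse_joined_refl; apply: AZ.
Qed.

Lemma unbounded_component_sub Z s A : unbounded_component Z s A -> A `<=` Z.
Proof. by move=> [[x _ ->] _] y xy; exact: (coarse_joined_mem xy).2. Qed.

Definition Cinfty_map Z' Z s' s (ZZ : Z' `<=` Z) (ss : s' <= s)
    (A : Cinfty Z' s') : Cinfty Z s :=
  exist _ (coarse_hull Z s (sval A)) (coarse_hull_component ZZ ss (svalP A)).

Lemma Cinfty_map_comp Z1 Z2 Z3 Z2' s1 s2 s3 s2'
    (Z12 : Z1 `<=` Z2) (Z23 : Z2 `<=` Z3)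
    (Z12' : Z1 `<=` Z2') (Z23' : Z2' `<=` Z3)
    (s12 : s1 <= s2) (s23 : s2 <= s3) (s12' : s1 <= s2') (s23' : s2' <= s3)
    (A : Cinfty Z1 s1) :
  Cinfty_map Z23 s23 (Cinfty_map Z12 s12 A) =
  Cinfty_map Z23' s23' (Cinfty_map Z12' s12' A).
Proof.
apply/eq_exist => /=; have AZ := unbounded_component_sub (svalP A).
by rewrite !coarse_hull_hull//; exact: subset_trans AZ _.
Qed.

Lemma thicken_compl_sub (C : set X) (mu mu' : {nonneg R}) :
  mu%:num <= mu'%:num -> ~` thicken C mu'%:num `<=` ~` thicken C mu%:num.
Proof.
move=> mumu; apply: subsetC => x [c Cc cx]; exists c => //.
exact: lt_le_trans mumu.
Qed.

End CoarseComponents.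

Section FilteredEnds.
Context {R : realType} (X : qpmet R).
Implicit Types (mu : {nonneg R}) (s : {posnum R}).

Definition ends_at s : Type :=
  @inv_limit {nonneg R} (fun mu mu' => mu%:num <= mu'%:num)
    (fun mu => Cinfty (~` thicken (base X) mu%:num) s%:num)
    (fun mu mu' mumu => Cinfty_map (thicken_compl_sub mumu) (lexx s%:num)).

Lemma ends_at_map_subproof s s' (ss : s%:num <= s'%:num) (x : ends_at s) :
  forall mu mu' (mumu : mu%:num <= mu'%:num),
    Cinfty_map (thicken_compl_sub mumu) (lexx s'%:num)
      (Cinfty_map (@subset_refl _ _) ss (sval x mu')) =
    Cinfty_map (@subset_refl _ _) ss (sval x mu).
Proof.
move=> mu mu' mumu; rewrite -(svalP x mu mu' mumu); exact: Cinfty_map_comp.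
Qed.

Definition ends_at_map s s' (ss : s%:num <= s'%:num) (x : ends_at s) :
    ends_at s' :=
  exist _ (fun mu => Cinfty_map (@subset_refl _ _) ss (sval x mu))
    (ends_at_map_subproof ss x).

Definition filtered_ends : Type :=
  @dir_limit {posnum R} (fun s s' => s%:num <= s'%:num) ends_at ends_at_map.

Definition fend s (x : ends_at s) : filtered_ends :=
  @dir_inj {posnum R} (fun s s' => s%:num <= s'%:num) ends_at ends_at_map s x.

Definition thread s (x : ends_at s) mu : set X := sval (sval x mu).

End FilteredEnds.

(* [u] is induced by [f]: for any admissible constants, a thread A at scale s
   is sent to the thread B at scale lam * s + eps such that
   f (A mu) `<=` B (mu / lam - eps - r) as soon as lam * (eps + r) <= mu. This
   last condition is expressed by nu being nonnegative. *)
Definition induced_by {R : realType} {X Y : qpmet R} (f : qpmor X Y)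
    (u : filtered_ends X -> filtered_ends Y) : Prop :=
  forall lam eps r : R, qi_bounds lam eps f -> 0 <= r ->
    base Y `<=` thicken (f @` base X) r ->
  forall s t : {posnum R}, t%:num = lam * s%:num + eps ->
  forall A : ends_at X s, exists2 B : ends_at Y t, u (fend A) = fend B &
    forall mu nu : {nonneg R}, nu%:num = mu%:num / lam - eps - r ->
      f @` thread A mu `<=` thread B nu.

Section Ends.
Context {R : realType} (X : metricType R).

Definition joined_in (Z : set X) (x y : X) : Prop :=
  exists gamma : R -> X,
    [/\ {within `[0, 1], continuous gamma}, gamma 0 = x, gamma 1 = y &
        gamma @` `[0, 1] `<=` Z].

Definition path_component (Z : set X) (x : X) : set X :=
  [set y | joined_in Z x y].

(* The values of [ray_fun] at negative numbers are irrelevant. *)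
Record proper_ray : Type := ProperRay {
  ray_fun :> R -> X;
  ray_continuous : {within `[0, +oo[, continuous ray_fun};
  ray_proper : forall K : set X, compact K ->
    compact (`[0, +oo[ `&` ray_fun @^-1` K) }.

Definition ray_eq (r1 r2 : proper_ray) : Prop :=
  forall K : set X, compact K -> exists (N : nat) (x : X),
    [/\ (~` K) x, r1 @` `[N%:R, +oo[ `<=` path_component (~` K) x &
        r2 @` `[N%:R, +oo[ `<=` path_component (~` K) x].

Definition ends : Type := classes ray_eq.

Definition end_of (r : proper_ray) : ends := class_of ray_eq r.

End Ends.

Arguments end_of {R X} r.

Definition proper_geodesic_compact {R : realType} (X : qpmet R) : Prop :=
  [/\ proper_space X, geodesic_space X & compact (base X)].

Section CayleyGraph.
Context (R : realType) {G : groupType}.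
Local Open Scope group_scope.

Definition generating (S : seq G) : Prop :=
  forall g : G, exists2 w : seq G,
    all (fun x => (x \in S) || (x^-1 \in S)) w & g = \prod_(x <- w) x.

Definition adjacent (S : seq G) (v w : G) : Prop :=
  exists2 s, s \in S & w = v * s \/ v = w * s.

Local Open Scope ring_scope.

(* The barycentric coordinates of the point at distance t from v on the edge
   from v to w; this is the vertex v when v = w. *)
Definition edge_point (v w : G) (t : R) : G -> R :=
  fun u => (1 - t) * (u == v)%:R + t * (u == w)%:R.

Definition cell (S : seq G) (v w : G) : Prop := v = w \/ adjacent S v w.

(* The geometric realization of the (simple) Cayley graph of G with respect to
   the finite generating set S. Points are given by their barycentric
   coordinates. Generation is needed for the path metric to be finite. *)
Definition cayley (S : seq G) (genS : generating S) : Type :=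
  {p : G -> R | exists (v w : G) (t : R),
    [/\ cell S v w, 0 <= t <= 1 & p = edge_point v w t]}.

HB.instance Definition _ S (genS : generating S) :=
  gen_eqMixin (cayley genS).
HB.instance Definition _ S (genS : generating S) :=
  gen_choiceMixin (cayley genS).

End CayleyGraph.

Arguments cayley R {G S} genS.

Section CayleyMetric.
Context {R : realType} {G : groupType} {S : seq G} (genS : generating S).
Notation X := (cayley R genS).
Implicit Types p q r : X.

Lemma cayley_eq p q : sval p = sval q -> p = q.
Proof. by case: p q => [p hp] [q hq] /=; apply: eq_exist. Qed.

Definition segment p q (l : R) : Prop :=
  exists (v w : G) (t t' : R),
    [/\ adjacent S v w, 0 <= t <= 1, 0 <= t' <= 1,
        sval p = edge_point v w t /\ sval q = edge_point v w t' &
        l = `|t - t'|].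

Inductive polygonal p : X -> R -> Prop :=
| polygonal_nil : polygonal p p 0
| polygonal_step q r l l' :
    polygonal p q l -> segment q r l' -> polygonal p r (l + l').

Definition path_dist p q : R := inf [set l | polygonal p q l].

Lemma segment_sym p q l : segment p q l -> segment q p l.
Proof.
move=> [v [w [t [t' [vw t01 t'01 [pE qE] ->]]]]].
by exists v, w, t', t; split=> //; rewrite distrC.
Qed.

Lemma polygonal_trans p q r l l' :
  polygonal p q l -> polygonal q r l' -> polygonal p r (l + l').
Proof.
move=> pq; elim=> [|q' r' l1 l2 _ IH qr]; first by rewrite addr0.
by rewrite addrA; apply: polygonal_step qr.
Qed.

Lemma polygonal_segment p q l : segment p q l -> polygonal p q l.
Proof. by move=> pq; rewrite -[l]add0r; apply: polygonal_step pq; left. Qed.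

Lemma polygonal_sym p q l : polygonal p q l -> polygonal q p l.
Proof.
elim=> [|q' r' l1 l2 _ IH qr]; first by left.
rewrite addrC; apply: polygonal_trans IH.
exact/polygonal_segment/segment_sym.
Qed.

Lemma polygonal_ge p q l : polygonal p q l ->
  forall u, `|sval p u - sval q u| <= l.
Proof.
elim=> [u|q' r' l1 l2 _ IH qr u]; first by rewrite subrr normr0.
apply: (le_trans (ler_distD (sval q' u) _ _)); rewrite lerD//.
case: qr => [v [w [t [t' [_ _ _ [-> ->] ->]]]]]; rewrite /edge_point.
have -> : (1 - t) * (u == v)%:R + t * (u == w)%:R -
    ((1 - t') * (u == v)%:R + t' * (u == w)%:R) =
    (t - t') * ((u == w)%:R - (u == v)%:R) :> R.

  by ring.
by rewrite normrM ler_piMr//; case: (u == w); case: (u == v);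
  rewrite ?subrr ?sub0r ?subr0 ?normrN ?normr1 ?normr0.
Qed.

Lemma vertex_subproof (x : G) : exists (v w : G) (t : R),
  [/\ cell S v w, 0 <= t <= 1 & edge_point x x 0 = edge_point v w t].
Proof. by exists x, x, 0; split; [left | rewrite lexx ler01 |]. Qed.

Definition vertex (v : G) : X :=
  exist _ (edge_point v v 0) (vertex_subproof v).

Lemma edge_point0 v w : edge_point v w 0 = sval (vertex v).
Proof. by apply/funext => u; rewrite /= /edge_point subr0 !mul0r. Qed.

Lemma edge_point1 v w : edge_point v w 1 = sval (vertex w).
Proof.
by apply/funext => u; rewrite /= /edge_point subrr subr0 !mul0r addrC.
Qed.

Lemma edge_pointxx v t : edge_point v v t = sval (vertex v).
Proof. by apply/funext => u; rewrite /= /edge_point; ring. Qed.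

Lemma segment_vertex v w : adjacent S v w -> segment (vertex v) (vertex w) 1.
Proof.
move=> vw; exists v, w, 0, 1; rewrite edge_point0 edge_point1.
by split; rewrite ?lexx ?ler01// sub0r normrN1.
Qed.

Lemma polygonal_to_vertex p : exists v l, polygonal p (vertex v) l.
Proof.
case: (svalP p) => v [w [t [vw t01 pE]]]; exists v.
case: vw => [wE|vw].
  exists 0; suff -> : p = vertex v by left.
  by apply: cayley_eq; rewrite pE -wE edge_pointxx.
exists `|t - 0|; apply: polygonal_segment; exists v, w, t, 0.
by rewrite edge_point0 lexx ler01.
Qed.

Lemma polygonal_vertices v w : exists l, polygonal (vertex v) (vertex w) l.
Proof.
have [s + wE] := genS (v^-1 * w)%g.
have {wE} -> : w = (v * \prod_(x <- s) x)%g by rewrite -wE mulVKg.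
elim: s v => [|x s IH] v /=; first by exists 0; rewrite big_nil mulg1; left.
move=> /andP[xS /(IH (v * x)%g)[l]]; rewrite big_cons mulgA => vxl.
exists (1 + l); apply: polygonal_trans vxl.
apply/polygonal_segment/segment_vertex.
case/orP: xS => xS; first by exists x => //; left.
by exists (x^-1)%g => //; right; rewrite mulgK.
Qed.

Lemma polygonal_nonempty p q : [set l | polygonal p q l] !=set0.
Proof.
have [v [l pv]] := polygonal_to_vertex p.
have [w [l' qw]] := polygonal_to_vertex q.
have [l'' vw] := polygonal_vertices v w.
exists (l + (l'' + l')).
exact: polygonal_trans pv (polygonal_trans vw (polygonal_sym qw)).
Qed.

Lemma polygonal_lbound p q (u : G) :
  lbound [set l | polygonal p q l] `|sval p u - sval q u|.
Proof. by move=> l /polygonal_ge. Qed.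

Lemma path_dist_le p q l : polygonal p q l -> path_dist p q <= l.
Proof.
move=> pq; apply: ge_inf => //.
by exists `|sval p 1%g - sval q 1%g|; apply: polygonal_lbound.
Qed.

Lemma path_distxx p : path_dist p p = 0.
Proof.
apply/le_anti/andP; split; first by apply: path_dist_le; left.
apply: lb_le_inf; first exact: polygonal_nonempty.
by move=> l /polygonal_ge/(_ 1%g); apply: le_trans.
Qed.

Lemma path_dist_eq0 p q : path_dist p q = 0 -> p = q.
Proof.
move=> pq0; apply: cayley_eq; apply/funext => u; apply/eqP.
rewrite -subr_eq0 -normr_le0.
apply: (@le_trans _ _ (path_dist p q)); last by rewrite pq0.
apply: lb_le_inf.
  exact: polygonal_nonempty.
exact: polygonal_lbound.
Qed.

Lemma path_dist_sym p q : path_dist p q = path_dist q p.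
Proof.
by congr inf; apply/seteqP; split=> l; apply: polygonal_sym.
Qed.

Lemma path_dist_triangle q p r :
  path_dist p r <= path_dist p q + path_dist q r.
Proof.
rewrite -lerBlDr; apply: lb_le_inf; first exact: polygonal_nonempty.
move=> l pq; rewrite lerBlDr addrC -lerBlDr; apply: lb_le_inf.
  exact: polygonal_nonempty.
move=> l' qr; rewrite lerBlDr addrC; apply: path_dist_le.
exact: polygonal_trans qr.
Qed.

HB.instance Definition _ := isMetric.Build R X
  path_distxx path_dist_eq0 path_dist_sym path_dist_triangle.

Lemma translate_subproof (g : G) p : exists (v w : G) (t : R),
  [/\ cell S v w, 0 <= t <= 1 &
      (fun u => sval p (g^-1 * u)%g) = edge_point v w t].
Proof.
case: (svalP p) => v [w [t [vw t01 pE]]]; exists (g * v)%g, (g * w)%g, t.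
split=> //.
  case: vw => [->|[s sS vws]]; first by left.
  by right; exists s => //; case: vws => ->; [left | right]; rewrite mulgA.
apply/funext => u; rewrite pE /edge_point.
by rewrite -!(inj_eq (mulgI g) (g^-1 * u)%g) !mulVKg.
Qed.

Definition translate (g : G) p : X :=
  exist _ (fun u => sval p (g^-1 * u)%g) (translate_subproof g p).

Lemma translate1 p : translate 1 p = p.
Proof. by apply: cayley_eq; apply/funext => u /=; rewrite invg1 mul1g. Qed.

Lemma translateM g h p : translate (g * h) p = translate g (translate h p).
Proof. by apply: cayley_eq; apply/funext => u /=; rewrite invgM mulgA. Qed.

(* A closed edge, or a vertex when v = w. *)
Definition closed_cell (v w : G) : set X :=
  [set p | exists2 t : R, 0 <= t <= 1 & sval p = edge_point v w t].

Definition subgraph (A : set X) : Prop :=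
  exists F : set (G * G), (forall e, F e -> cell S e.1 e.2) /\
    A = \bigcup_(e in F) closed_cell e.1 e.2.

End CayleyMetric.

Arguments vertex R {G S} genS v.

Section Coends.
Context {R : realType} {G : groupType} {S : seq G} (genS : generating S).
Context (P : groupClosed G).
Notation X := (cayley R genS).

Definition same_orbit (A : set X) (x y : A) : bool :=
  `[< exists2 g, g \in P & translate g (val x) = val y >].

Lemma same_orbit_refl (A : set X) : reflexive (@same_orbit A).
Proof.
by move=> x; apply/asboolP; exists 1%g; rewrite ?translate1 ?gpred1.
Qed.

Lemma same_orbit_sym (A : set X) : symmetric (@same_orbit A).
Proof.
suff orb_sym (x y : A) : same_orbit x y -> same_orbit y x.
  by move=> x y; apply/idP/idP; apply: orb_sym.
move=> /asboolP[g gP gxy]; apply/asboolP; exists (g^-1)%g.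
  by rewrite gpredV.
by rewrite -gxy -translateM mulVg translate1.
Qed.

Lemma same_orbit_trans (A : set X) : transitive (@same_orbit A).
Proof.
move=> y x z /asboolP[g gP gxy] /asboolP[h hP hyz]; apply/asboolP.
by exists (h * g)%g; rewrite ?gpredM// translateM gxy.
Qed.

Canonical same_orbit_equiv (A : set X) := EquivRel (@same_orbit A)
  (@same_orbit_refl A) (@same_orbit_sym A) (@same_orbit_trans A).

Definition orbit_space (A : set X) : topologicalType :=
  quotient_topology {eq_quot same_orbit_equiv A}%qT.

Definition invariant (A : set X) : Prop :=
  forall g p, g \in P -> A p -> A (translate g p).

Definition cocompact_subgraph (A : set X) : Prop :=
  [/\ subgraph A, A !=set0, connected A, invariant A &
      compact [set: orbit_space A]].

Definition coend_component (A K : set X) : Prop :=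
  (exists2 x, (~` A) x & K = connected_component (~` A) x) /\
  ~ exists B, [/\ cocompact_subgraph B, B <> A & K `<=` B].

(* The component of X - A containing K, when K is connected in X - A. *)
Definition component_hull (A K : set X) : set X :=
  \bigcup_(x in K) connected_component (~` A) x.

Lemma component_hull_coend (A B K : set X) : A `<=` B ->
  coend_component B K -> coend_component A (component_hull A K).
Proof.
move=> AB [[x Bx KE] Kinf].
have Kx : K x by rewrite KE; apply: connected_component_refl.
have Ax : (~` A) x by move/AB.
have hullE : component_hull A K = connected_component (~` A) x.
  apply/seteqP; split=> y; last by exists x.
  move=> [z]; rewrite KE => xz zy; apply: connected_component_trans zy.
  case: xz => C [Cx CB Ccon Cz]; exists C => //; split=> //.
  by apply: subset_trans CB _; apply: subsetC.
split; first by exists x.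
apply: contra_not Kinf => -[C [SC CA KC]]; exists C.
have KC' : K `<=` C.
  by move=> y Ky; apply: KC; exists y => //; apply: connected_component_refl;
    move: Ky; rewrite KE => /connected_component_sub By /AB.
by split=> // CB; apply: Bx; rewrite -CB; apply: KC'.
Qed.

Definition coends : Type :=
  @inv_limit {A : set X | cocompact_subgraph A}
    (fun A B => sval A `<=` sval B)
    (fun A => {K : set X | coend_component (sval A) K})
    (fun A B AB K => exist _ (component_hull (sval A) (sval K))
                           (component_hull_coend AB (svalP K))).

Lemma vertices_nonempty :
  [set vertex R genS g | g in [set g | g \in P]] !=set0.
Proof. by exists (vertex R genS 1%g), 1%g => //=; exact: gpred1. Qed.

Definition cayley_pair : qpmet R := QPMet vertices_nonempty.

End Coends.

Arguments coends R {G S} genS P.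
Arguments cayley_pair R {G S} genS P.

(* Main.v *)
Require Import Defs.
From mathcomp Require Import all_boot all_order all_algebra.
From mathcomp Require Import boolp classical_sets cardinality reals ereal.
From mathcomp Require Import topology.
From mathcomp Require Import interval_inference generic_quotient functions.
From mathcomp Require Import normedtype ring lra.

(** Call [A], a thread of [X], tracked by a thread [B] of [Y] along [f] when
    every [B nu] contains [f (A mu)] for some [mu]. Every thread is tracked
    along a morphism, and the class of [B] depends only on that of [A] and on
    [f] up to bounded distance; functoriality, invariance under bounded
    perturbation and under quasi-isometries follow.

    In a proper geodesic space with compact base, a thread is followed by a
    proper ray (fill in coarse chains with geodesics), and conversely a ray
    eventually lies in one coarse component at each radius, as connected sets
    are coarsely connected at every scale; a ray eventually in every [A mu]
    determines, and is determined by, the class of [A].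

    For a Cayley graph, a cocompact subgraph lies in a metric neighbourhood of
    [P], and any such neighbourhood lies in the subgraph spanned by a ball
    around [P], which is cocompact and, for large radii, connected as it
    contains a connected cocompact subgraph. So both notions of ends are
    inverse limits over the same exhaustion, of the components that contain
    points arbitrarily far from [P]; coarse components and connected components
    are interleaved since nearby points of the graph are joined by short
    paths. *)

Set Implicit Arguments.
Unset Strict Implicit.
Unset Printing Implicit Defensive.

Import Order.TTheory GRing.Theory Num.Theory.
Import numFieldTopology.Exports.
Local Open Scope classical_set_scope.
Local Open Scope card_scope.
Local Open Scope ring_scope.

(** * Functoriality *)

Section CoarseJoined.
Context {R : realType} {X : metricType R}.
Implicit Types (Z A : set X) (s : R).

Lemma coarse_joined_step Z s x y :
  Z x -> Z y -> mdist x y <= s -> coarse_joined Z s x y.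
Proof.
move=> Zx Zy xy; exists [:: y]; split=> //=; first by rewrite xy.
by move=> z; rewrite !inE => /orP[] /eqP->.
Qed.

(** The induction principle behind every transport of chains: it suffices to treat single steps,
    provided the target relation is reflexive on [Z] and transitive. *)
Lemma coarse_joined_ind Z s (e : X -> X -> Prop) :
  (forall x, Z x -> e x x) ->
  (forall x y z, e x y -> e y z -> e x z) ->
  (forall x y, Z x -> Z y -> mdist x y <= s -> e x y) ->
  forall x y, coarse_joined Z s x y -> e x y.
Proof.
move=> er et es x y [p [+ + Zp]].
elim: p x Zp => [|z p IH] x Zp /=.
  by move=> _ <-; apply/er/Zp; rewrite mem_head.
move=> /andP[xz zp] py; apply: (et _ z).
  by apply: es => //; apply: Zp; rewrite !inE eqxx ?orbT.
by apply: IH => // w wp; apply: Zp; rewrite inE wp orbT.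
Qed.

Lemma coarse_joined_sym Z s x y :
  coarse_joined Z s x y -> coarse_joined Z s y x.
Proof.
apply: (@coarse_joined_ind Z s (fun x y => coarse_joined Z s y x)).
- exact: coarse_joined_refl.
- by move=> a b c ab bc; apply: coarse_joined_trans ab.
- by move=> a b Za Zb ab; apply: coarse_joined_step; rewrite // metric_sym.
Qed.

Lemma unbounded_component_eq Z s A x :
  unbounded_component Z s A -> A x -> A = coarse_component Z s x.
Proof.
move=> [[y _ ->] _] yx; apply/seteqP; split=> z.
  by apply: coarse_joined_trans; apply: coarse_joined_sym.
exact: coarse_joined_trans.
Qed.

Lemma unbounded_nonempty A : ~ bounded A -> exists x, A x.
Proof.
move=> Ab; apply: contrapT => A0; apply: Ab.
by exists 0 => x y Ax; exfalso; apply: A0; exists x.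
Qed.

Lemma unbounded_superset A B : A `<=` B -> ~ bounded A -> ~ bounded B.
Proof.
move=> AB; apply: contra_not => -[M BM]; exists M => x y /AB Bx /AB; exact: BM.
Qed.

End CoarseJoined.

(** * Threads and equality of filtered ends *)

Section Threads.
Context {R : realType} {X : qpmet R}.
Implicit Types (mu : {nonneg R}) (s : {posnum R}).

(** The radius is an arbitrary real, so that expressions such as [lam * (nu + eps + r)] can be used
    without a proof of their sign. *)
Definition away (nu : R) : set X := ~` thicken (base X) nu.

Lemma awayP nu x : away nu x <-> forall c, base X c -> nu <= mdist c x.
Proof.
split=> [xC c Cc|xC [c Cc]].
  by rewrite leNgt; apply/negP => cx; apply: xC; exists c.
by rewrite ltNge xC.
Qed.

Lemma away_le (nu nu' : R) x : nu <= nu' -> away nu' x -> away nu x.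
Proof. by move=> le /awayP xC; apply/awayP => c /xC; apply: le_trans. Qed.

Lemma thread_component s (A : ends_at X s) mu :
  unbounded_component (away mu%:num) s%:num (thread A mu).
Proof. exact: svalP (sval A mu). Qed.

Lemma thread_away s (A : ends_at X s) mu : thread A mu `<=` away mu%:num.
Proof. exact: unbounded_component_sub (thread_component A mu). Qed.

Lemma thread_nonempty s (A : ends_at X s) mu : exists x, thread A mu x.
Proof. by have [_ /unbounded_nonempty] := thread_component A mu. Qed.

Lemma thread_joined s (A : ends_at X s) mu x y : thread A mu x ->
  thread A mu y <-> coarse_joined (away mu%:num) s%:num x y.
Proof. by move=> /(unbounded_component_eq (thread_component A mu))->. Qed.

Lemma thread_le s (A : ends_at X s) mu mu' :
  mu%:num <= mu'%:num -> thread A mu' `<=` thread A mu.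
Proof.
move=> mumu x Ax; rewrite /thread -(svalP A mu mu' mumu) /=.
exists x => //; apply: coarse_joined_refl.
by apply: away_le mumu _; apply: thread_away Ax.
Qed.

(** All threads are built this way: an unbounded, coarsely joined seed [W mu] singles out the
    component containing it. The seeds need not be nested; one link between [W mu'] and [W mu]
    already forces the component at [mu'] into the one at [mu]. *)
Lemma thread_of_seeds s (W : {nonneg R} -> set X) :
  (forall mu, ~ bounded (W mu)) ->
  (forall mu x y, W mu x -> W mu y ->
    coarse_joined (away mu%:num) s%:num x y) ->
  (forall mu mu', mu%:num <= mu'%:num -> exists x y,
    [/\ W mu' x, W mu y & coarse_joined (away mu%:num) s%:num x y]) ->
  exists A : ends_at X s, forall mu, W mu `<=` thread A mu.
Proof.
move=> Wb Wj Wc; pose T mu := coarse_hull (away mu%:num) s%:num (W mu).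
have WT mu : W mu `<=` T mu by move=> x Wx; exists x => //; apply: Wj.
have TP mu : unbounded_component (away mu%:num) s%:num (T mu).
  split; last exact: unbounded_superset (WT mu) (Wb mu).
  have [x Wx] := unbounded_nonempty (Wb mu).
  exists x; first by have [] := coarse_joined_mem (Wj _ _ _ Wx Wx).
  apply/seteqP; split=> y; last by exists x.
  by move=> [z Wz]; apply: coarse_joined_trans; apply: Wj.
have TC mu mu' (mumu : mu%:num <= mu'%:num) :
    Cinfty_map (thicken_compl_sub mumu) (lexx s%:num) (exist _ _ (TP mu')) =
    exist _ _ (TP mu).
  apply/eq_exist => /=; have [x [y [Wx Wy xy]]] := Wc _ _ mumu.
  apply/seteqP; split=> z.
    move=> [w [v Wv vw] wz]; exists y => //.
    apply: coarse_joined_trans wz.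
    apply: coarse_joined_trans (coarse_joined_sym xy) _.
    have: coarse_joined (away mu'%:num) s%:num x w.
      by apply: coarse_joined_trans vw; apply: Wj.
    by apply: coarse_joined_sub => // u; apply: away_le.
  move=> [w Ww wz]; exists x; first exact: WT.
  apply: coarse_joined_trans xy _; apply: coarse_joined_trans wz.
  exact: Wj.
by exists (exist _ (fun mu => exist _ _ (TP mu)) TC) => mu; apply: WT.
Qed.

Local Notation germ := (@germ_eq {posnum R} (fun s s' => s%:num <= s'%:num)
  (ends_at X) (@ends_at_map R X)).

(** Two components have the same hull at scale [k] exactly when their points are [k]-joined, so an
    equality of dependent families becomes a condition on points. *)
Lemma germ_eqE s s' (A : ends_at X s) (A' : ends_at X s') :
  germ (existT _ s A) (existT _ s' A') <->
  exists k : {posnum R}, [/\ s%:num <= k%:num, s'%:num <= k%:num &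
    forall mu x y, thread A mu x -> thread A' mu y ->
      coarse_joined (away mu%:num) k%:num x y].
Proof.
split=> [[k [/= sk [s'k AA]]]|[k [sk s'k AA]]].
  exists k; split=> // mu x y Ax A'y.
  have /(congr1 (fun E => E x)) /= : thread (ends_at_map sk A) mu =
    thread (ends_at_map s'k A') mu by rewrite AA.
  have Ax' : coarse_hull (away mu%:num) k%:num (thread A mu) x.
    by exists x => //; apply/coarse_joined_refl/(thread_away Ax).
  rewrite /thread/= => AA'; move: (Ax'); rewrite /coarse_hull/=.
  rewrite /thread/= in Ax'; rewrite AA' in Ax'.
  move=> _; case: Ax' => z A'z zx; apply: coarse_joined_sym.
  apply: coarse_joined_trans zx.
  have := (thread_joined z A'y).1 A'z; exact: coarse_joined_sub.
exists k, sk, s'k; apply: eq_exist; apply: functional_extensionality_dep => mu.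
apply/eq_exist => /=.
have [x Ax] := thread_nonempty A mu; have [y A'y] := thread_nonempty A' mu.
apply/seteqP; split=> z [w Aw wz]; [exists y|exists x] => //;
    apply: coarse_joined_trans wz.
  by apply: coarse_joined_sym; apply: AA.
exact: AA.
Qed.

Lemma germ_eq_refl (a : {s & ends_at X s}) : germ a a.
Proof.
case: a => s A; apply/germ_eqE; exists s; split=> // mu x y Ax.
exact: (thread_joined _ _).1.
Qed.

Lemma germ_eq_sym (a b : {s & ends_at X s}) :
  germ a b -> germ b a.
Proof. by move=> [k [ak [bk ab]]]; exists k, bk, ak. Qed.

Lemma germ_eq_trans (b a c : {s & ends_at X s}) :
  germ a b -> germ b c -> germ a c.
Proof.
case: a b c => [s A] [s' A'] [s'' A''].
move=> /germ_eqE[k [sk s'k AA]] /germ_eqE[l [s'l s''l AA']]; apply/germ_eqE.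
have kp : 0 < Num.max k%:num l%:num by rewrite lt_max gt0.
exists (PosNum kp); split=> [||mu x y Ax Ay] /=.
- by rewrite le_max sk.
- by rewrite le_max s''l orbT.
have [z Az] := thread_nonempty A' mu.
apply: (@coarse_joined_trans _ _ _ _ _ z).
  by apply: coarse_joined_sub (AA _ _ _ Ax Az); rewrite // le_max lexx.
by apply: coarse_joined_sub (AA' _ _ _ Az Ay); rewrite // le_max lexx orbT.
Qed.

Lemma fendP (x : filtered_ends X) : exists s (A : ends_at X s), x = fend A.
Proof.
case: x => c [[s A] cE]; exists s, A.
by rewrite /fend/dir_inj/class_of; apply/eq_exist.
Qed.

Lemma fend_eqP s s' (A : ends_at X s) (A' : ends_at X s') :
  fend A = fend A' <->
  exists k : {posnum R}, [/\ s%:num <= k%:num, s'%:num <= k%:num &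
    forall mu x y, thread A mu x -> thread A' mu y ->
      coarse_joined (away mu%:num) k%:num x y].
Proof.
rewrite -germ_eqE; split=> [|AA'].
  move=> /(congr1 (fun c => sval c (existT _ s' A'))) /= ->.
  exact: germ_eq_refl.
rewrite /fend/dir_inj/class_of; apply/eq_exist/seteqP; split=> b /=.
  exact: germ_eq_trans (germ_eq_sym AA').
exact: germ_eq_trans AA'.
Qed.

(** One linked pair at each level is enough, since each component is itself coarsely joined. The
    scale [k] must be uniform in [mu]; enlarging it to the maximum with [s] and [s'] makes it
    positive and admissible. *)
Lemma fend_eq (k : R) s s' (A : ends_at X s) (A' : ends_at X s') :
  (forall mu, exists x y, [/\ thread A mu x, thread A' mu y &
    coarse_joined (away mu%:num) k x y]) -> fend A = fend A'.
Proof.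
move=> AA; apply/fend_eqP.
have kp : 0 < Num.max k (Num.max s%:num s'%:num) by rewrite !lt_max !gt0 !orbT.
exists (PosNum kp); split=> [||mu x y Ax Ay] /=.
- by rewrite !le_max lexx !orbT.
- by rewrite !le_max lexx !orbT.
have [x' [y' [Ax' Ay' x'y']]] := AA mu.
apply: (@coarse_joined_trans _ _ _ _ _ x').
  by apply: coarse_joined_sub ((thread_joined x' Ax).1 Ax');
    rewrite // !le_max lexx !orbT.
apply: (@coarse_joined_trans _ _ _ _ _ y').
  by apply: coarse_joined_sub x'y'; rewrite // !le_max lexx.
by apply: coarse_joined_sub ((thread_joined y Ay').1 Ay);
  rewrite // !le_max lexx !orbT.
Qed.

End Threads.

(** * The maps induced on filtered ends *)

Section Functor.
Context {R : realType}.
Implicit Types X Y Z : qpmet R.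

(** No quasi-isometry constants appear, so tracking composes at once and makes sense along any
    function. *)
Definition tracks X Y (f : X -> Y) (s t : {posnum R}) (A : ends_at X s)
    (B : ends_at Y t) : Prop :=
  forall nu : {nonneg R}, exists mu : {nonneg R},
    f @` thread A mu `<=` thread B nu.

(** A point [d] of the base of [Y] is within [r] of some [f c], and [f c] is at distance at least
    [mdist c x / lam - eps] from [f x]; the radius is chosen so that [nu] remains after subtracting
    [r]. *)
Lemma away_map X Y (f : X -> Y) (lam eps r nu : R) x : qi_bounds lam eps f ->
  base Y `<=` thicken (f @` base X) r ->
  away (lam * (nu + eps + r)) x -> away nu (f x).
Proof.
move=> [lam1 _ fqi] Dr /awayP xC; apply/awayP => d /Dr[_ [c Cc <-] cd].
have lam0 : 0 < lam by apply: lt_le_trans lam1.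
have /andP[+ _] := fqi c x.
have : nu + eps + r <= lam^-1 * mdist c x by rewrite ler_pdivlMl//; apply: xC.
have := metric_triangle (f c) d (f x); lra.
Qed.

Lemma coarse_joined_map X Y (f : X -> Y) (lam eps r nu s : R) x y :
  qi_bounds lam eps f -> base Y `<=` thicken (f @` base X) r ->
  coarse_joined (away (lam * (nu + eps + r))) s x y ->
  coarse_joined (away nu) (lam * s + eps) (f x) (f y).
Proof.
move=> fqi Dr; have fa := away_map fqi Dr.
apply: (@coarse_joined_ind _ _ _ _
  (fun x y => coarse_joined (away nu) (lam * s + eps) (f x) (f y))).
- by move=> a /fa; apply: coarse_joined_refl.
- by move=> a b c; apply: coarse_joined_trans.
- move=> a b /fa Za /fa Zb ab; apply: coarse_joined_step => //.
  have [lam1 _ /(_ a b)/andP[_ /le_trans->//]] := fqi.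
  by rewrite lerD2r ler_wpM2l// (le_trans ler01).
Qed.

Lemma unbounded_image (X Y : qpmet R) (f : X -> Y) (lam eps : R) (A : set X) :
  qi_bounds lam eps f -> ~ bounded A -> ~ bounded (f @` A).
Proof.
move=> [lam1 _ fqi]; apply: contra_not => -[M AM].
exists (lam * (M + eps)) => x y Ax Ay.
have lam0 : 0 < lam by apply: lt_le_trans lam1.
rewrite -ler_pdivrMl//; have /andP[+ _] := fqi x y.
have : mdist (f x) (f y) <= M by apply: AM; [exists x|exists y].
lra.
Qed.

(** The images under [f] of the components of [A] serve as seeds in [Y]: a quasi-isometric image of
    an unbounded set is unbounded, and chains are carried to chains. *)
Lemma induced_thread X Y (f : X -> Y) (lam eps r : R) : qi_bounds lam eps f ->
  0 <= r -> base Y `<=` thicken (f @` base X) r ->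
  forall s t : {posnum R}, t%:num = lam * s%:num + eps ->
  forall A : ends_at X s, exists B : ends_at Y t,
    forall mu nu : {nonneg R}, nu%:num = mu%:num / lam - eps - r ->
      f @` thread A mu `<=` thread B nu.
Proof.
move=> fqi r0 Dr s t tE A; have [lam1 eps0 _] := fqi.
have lam0 : 0 < lam by apply: lt_le_trans lam1.
have pos (nu : {nonneg R}) : 0 <= lam * (nu%:num + eps + r).
  by rewrite mulr_ge0 ?(ltW lam0)// !addr_ge0.
(* [up] is the inverse of [mu |-> mu / lam - eps - r], so the seed at level [nu] comes from exactly
   the [mu] required by the conclusion. *)
pose up nu := NngNum (pos nu).
have [|nu _ _ [x Ax <-] [y Ay <-]|mu mu' mumu|B BP] :=
    @thread_of_seeds _ Y t (fun nu => f @` thread A (up nu)).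
- by move=> nu; apply: unbounded_image fqi (thread_component A _).2.
- rewrite tE; apply: (coarse_joined_map fqi Dr).
  exact: (thread_joined y Ax).1.
- have [x Ax] := thread_nonempty A (up mu').
  have Ax' : thread A (up mu) x.
    by apply: thread_le Ax; rewrite /= ler_pM2l// !lerD2r.
  exists (f x), (f x); split; [by exists x|by exists x|].
  rewrite tE; apply: (coarse_joined_map fqi Dr).
  exact: (thread_joined x Ax').1.
exists B => mu nu nuE; suff <- : up nu = mu by apply: BP.
apply/val_inj => /=; rewrite nuE; field.
by rewrite gt_eqF.
Qed.

Lemma tracks_exists X Y (f : qpmor X Y) (s : {posnum R}) (A : ends_at X s) :
  exists (t : {posnum R}) (B : ends_at Y t), tracks f A B.
Proof.
have [[lam [eps fqi]] [r r0 Dr]] := qpmorP f.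
have [lam1 eps0 _] := fqi; have lam0 : 0 < lam by apply: lt_le_trans lam1.
have t0 : 0 < lam * s%:num + eps by rewrite ltr_pwDl// mulr_gt0.
have [B BP] := @induced_thread _ _ f _ _ _ fqi r0 Dr s (PosNum t0) erefl A.
exists (PosNum t0), B => nu.
have mu0 : 0 <= lam * (nu%:num + eps + r).
  by rewrite mulr_ge0 ?(ltW lam0)// !addr_ge0.
by exists (NngNum mu0); apply: BP => /=; field; rewrite gt_eqF.
Qed.

Lemma tracks_le X Y (f : X -> Y) (s t : {posnum R}) (A : ends_at X s)
    (B : ends_at Y t) nu : tracks f A B ->
  exists mu : R, forall mu' : {nonneg R}, mu <= mu'%:num ->
    f @` thread A mu' `<=` thread B nu.
Proof.
move=> /(_ nu)[mu fA]; exists mu%:num => mu' mumu.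
by apply: subset_trans fA; apply: image_subset; apply: thread_le.
Qed.

(** This single comparison yields independence of the representative and of the tracking thread, and
    invariance under bounded perturbation: a chain from [x] to [y] far from the base is mapped by
    [f], then one step of length at most [K] leads from [f y] to [f' y]. *)
Lemma tracks_uniq X Y (f : qpmor X Y) (f' : X -> Y) (K : R)
    (s s' t t' : {posnum R}) (A : ends_at X s) (A' : ends_at X s')
    (B : ends_at Y t) (B' : ends_at Y t') :
  (forall x, mdist (f x) (f' x) <= K) -> fend A = fend A' ->
  tracks f A B -> tracks f' A' B' -> fend B = fend B'.
Proof.
move=> fK /fend_eqP[k [_ _ AA]] fAB fAB'.
have [[lam [eps fqi]] [r r0 Dr]] := qpmorP f.
apply: (@fend_eq _ _ (Num.max (lam * k%:num + eps) K)) => nu.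
have [mu1 fA] := tracks_le nu fAB; have [mu2 fA'] := tracks_le nu fAB'.
pose m := lam * (nu%:num + eps + r).
(* The level lies beyond both tracking thresholds and beyond the radius [m] from which [f] keeps
   chains away from the base; the [0] makes it nonnegative. *)
have m0 : 0 <= Num.max (Num.max mu1 mu2) (Num.max 0 m).
  by rewrite !le_max lexx !orbT.
pose mu := NngNum m0.
have [x Ax] := thread_nonempty A mu; have [y Ay] := thread_nonempty A' mu.
have Bx : thread B nu (f x).
  by apply: (fA mu); [rewrite /= !le_max lexx | exists x].
have By : thread B' nu (f' y).
  by apply: (fA' mu); [rewrite /= !le_max lexx orbT | exists y].
exists (f x), (f' y); split=> //.
have fxy : coarse_joined (away nu%:num) (lam * k%:num + eps) (f x) (f y).
  apply: coarse_joined_map fqi Dr _; apply: coarse_joined_sub (AA _ _ _ Ax Ay).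
    by move=> z; apply: away_le; rewrite /= !le_max lexx !orbT.
  by [].
apply: (@coarse_joined_trans _ _ _ _ _ (f y)).
  by apply: coarse_joined_sub fxy; rewrite // le_max lexx.
apply: coarse_joined_step; first exact: (coarse_joined_mem fxy).2.
  exact: thread_away By.
by rewrite le_max fK orbT.
Qed.

Lemma end_map_exists X Y (f : qpmor X Y) (x : filtered_ends X) :
  exists y : filtered_ends Y,
    forall (s t : {posnum R}) (A : ends_at X s) (B : ends_at Y t),
      x = fend A -> tracks f A B -> y = fend B.
Proof.
have [s [A ->]] := fendP x; have [t [B AB]] := tracks_exists f A.
exists (fend B) => s' t' A' B' AA AB'.
by apply: (@tracks_uniq _ _ f f 0) AA AB AB' => z; rewrite mdistxx.
Qed.

Definition end_map X Y (f : qpmor X Y) (x : filtered_ends X) :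
  filtered_ends Y := sval (cid (end_map_exists f x)).

Lemma end_mapE X Y (f : qpmor X Y) (s t : {posnum R}) (A : ends_at X s)
  (B : ends_at Y t) : tracks f A B -> end_map f (fend A) = fend B.
Proof. by rewrite /end_map; case: cid => y /= yP; apply: yP. Qed.

Lemma end_map_induced X Y (f : qpmor X Y) : induced_by f (end_map f).
Proof.
move=> lam eps r fqi r0 Dr s t tE A.
have [B BP] := induced_thread fqi r0 Dr tE A; exists B => //.
apply: end_mapE => nu; have [lam1 eps0 _] := fqi.
have lam0 : 0 < lam by apply: lt_le_trans lam1.
have mu0 : 0 <= lam * (nu%:num + eps + r).
  by rewrite mulr_ge0 ?(ltW lam0)// !addr_ge0.
by exists (NngNum mu0); apply: BP => /=; field; rewrite gt_eqF.
Qed.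

(** Every thread tracks itself along the identity, and [f] is compared with the identity by
    [tracks_uniq]. *)
Lemma end_map_near_id X (f : qpmor X X) :
  (exists2 r : R, 0 <= r & forall x, mdist (f x) x <= r) ->
  end_map f = idfun.
Proof.
move=> [r _ fr]; apply/funext => x; have [s [A ->]] := fendP x.
have [t [B AB]] := tracks_exists f A; rewrite (end_mapE AB) /=.
apply: (@tracks_uniq _ _ f idfun r) erefl AB _ => // nu.
by exists nu; rewrite image_id.
Qed.

Lemma end_map_comp X Y Z (g : qpmor Y Z) (f : qpmor X Y) :
  end_map (qpcomp g f) = end_map g \o end_map f.
Proof.
apply/funext => x; have [s [A ->]] := fendP x.
have [t [B AB]] := tracks_exists f A; have [u [C BC]] := tracks_exists g B.
rewrite /= (end_mapE AB) (end_mapE BC); apply: end_mapE => nu.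
have [mu BC'] := BC nu; have [mu' AB'] := AB mu; exists mu'.
move=> _ [a Aa <-] /=; apply: BC'; exists (f a) => //.
by apply: AB'; exists a.
Qed.

(** For the lower bound, [x] and [x'] are compared with their images under [g \o f]: this costs
    [eps] at each end and one more for the Lipschitz bound of [g], hence [3 * eps]. *)
Lemma quasi_isometry_qi (X Y : metricType R) (f : X -> Y) :
  quasi_isometry f -> quasi_isometric f.
Proof.
move=> [lam [eps [g [lam1 eps0 fL gL [gf _]]]]].
have lam0 : 0 < lam by apply: lt_le_trans lam1.
exists lam, (3 * eps); split=> // [|x x']; first by rewrite mulr_ge0.
apply/andP; split; last by have := fL x x'; lra.
have h : mdist x x' - 3 * eps <= lam * mdist (f x) (f x').
  have := gL (f x) (f x'); have := gf x; have := gf x'.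
  have := metric_triangle x (g (f x)) x'.
  have := metric_triangle (g (f x)) (g (f x')) x'.
  by rewrite (metric_sym x (g (f x))); lra.
rewrite lerBlDr ler_pdivrMl// mulrDr.
have : 3 * eps <= lam * (3 * eps) by rewrite ler_peMl// mulr_ge0.
lra.
Qed.

(** The coarse inverse [g] is a morphism as well, and both composites are close to identities, so
    functoriality makes the two end maps mutually inverse. *)
Lemma quasi_isometry_end_map X Y (f : X -> Y) : quasi_isometry f ->
  (hdist (f @` base X) (base Y) < +oo)%E ->
  exists2 m : qpmor X Y, qpfun m = f & bijective (end_map m).
Proof.
move=> fqi; have [lam [eps [g [lam1 eps0 fL gL [gf fg]]]]] := fqi.
move=> /ereal_inf_lt[_ [r [r0 fCD DfC] <-] _].
have fm : qp_morphism f by split; [apply: quasi_isometry_qi|exists r].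
have gm : @qp_morphism _ Y X g.
  split; first by apply: quasi_isometry_qi; exists lam, eps, f.
  (* For [d] within [r] of [f c], [g d] is within [lam * r + eps] of [g (f c)], which is within
     [eps] of [c]; the [1] makes the inequality strict. *)
  exists (lam * r + eps + eps + 1).
    have : 0 <= lam * r by rewrite mulr_ge0// (le_trans ler01).
    lra.
  move=> c Cc; have [|d Dd dc] := fCD (f c); first by exists c.
  exists (g d); first by exists d.
  have := metric_triangle (g d) (g (f c)) c; have := gf c; have := gL d (f c).
  have : lam * mdist d (f c) <= lam * r.
    by rewrite ler_wpM2l ?(le_trans ler01)// ltW.
  lra.
exists (QPMor fm) => //; exists (end_map (QPMor gm)) => x.
  by rewrite -[LHS]/((end_map _ \o end_map _) x) -end_map_comp
    end_map_near_id//; exists eps.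
by rewrite -[LHS]/((end_map _ \o end_map _) x) -end_map_comp
  end_map_near_id//; exists eps.
Qed.

End Functor.

(** * Comparison with the ends of a proper geodesic space *)

Lemma compact_exhaust (T : topologicalType) (K : set T) (U : nat -> set T) :
  compact K -> (forall n, open (U n)) ->
  (forall n m, (n <= m)%N -> U n `<=` U m) -> K `<=` \bigcup_n U n ->
  exists n, K `<=` U n.
Proof.
move=> /compact_near_coveringP cK Uo Ule KU.
have [x /KU[n _ Ux]|n _ Kn] := cK nat \oo U _.
  exists (U n, [set m | (n <= m)%N]) => /=.
    split; last by exists n.
    exact: open_nbhs_nbhs.
  by move=> [y m] /= [Uy nm]; apply: Ule nm _ Uy.
by exists n; apply: Kn => /=.
Qed.

(** * Connectedness, continuity and paths in metric spaces *)

Section MetricTopology.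
Context {R : realType} {X : metricType R}.
Implicit Types (A C W Z : set X) (f g : R -> X).

Lemma open_thicken C (r : R) : open (thicken C r).
Proof.
rewrite openE => x [c Cc cx]; apply/nbhs_ballP.
exists (r - mdist c x); first by rewrite /= subr_gt0.
move=> y; rewrite ballEmdist /= => xy; exists c => //.
have := metric_triangle c x y; lra.
Qed.

Lemma compact_metric_bounded C : compact C -> bounded C.
Proof.
move=> cC; have [C0|/existsNP[c /contrapT Cc]] := pselect (forall c, ~ C c).
  by exists 0 => x y /C0.
have [n|||n CU] := @compact_exhaust _ C (fun n => thicken [set c] n%:R) cC.
- exact: open_thicken.
- move=> n m nm x [_ -> cx]; exists c => //; apply: lt_le_trans cx _.
  by rewrite ler_nat.
- by move=> x _; exists (Num.bound (mdist c x)) => //; exists c => //;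
    apply: archi_boundP; exact: mdist_ge0.
exists (n%:R + n%:R) => x y /CU[_ -> cx] /CU[_ -> cy].
have := metric_triangle x c y; rewrite (metric_sym x c); lra.
Qed.

Lemma bounded_thicken C c A : C c -> bounded A ->
  exists m : {nonneg R}, A `<=` thicken C m%:num.
Proof.
move=> Cc [M AM]; have [A0|/existsNP[a /contrapT Aa]] :=
    pselect (forall a, ~ A a).
  by exists 0%:nng => a /A0.
have m0 : 0 <= mdist c a + `|M| + 1 by rewrite !addr_ge0 ?mdist_ge0.
exists (NngNum m0) => b Ab; exists c => //=.
have := metric_triangle c a b; have := AM _ _ Aa Ab; have := ler_norm M; lra.
Qed.

(** The points of [W] joined to [x] form a subset that is open and closed in [W], because moving by
    less than [s] within [W] does not change membership. *)
Lemma connected_coarse_joined W Z (s : R) x y : connected W -> W `<=` Z ->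
  0 < s -> W x -> W y -> coarse_joined Z s x y.
Proof.
move=> Wcon WZ s0 Wx Wy; pose B := [set z | W z /\ coarse_joined Z s x z].
suff BW : B = W by have [] : B y by rewrite BW.
have near u v : B u -> W v -> mdist u v < s -> B v.
  move=> [Wu xu] Wv uv; split=> //; apply: coarse_joined_trans xu _.
  by apply: coarse_joined_step; [exact: WZ | exact: WZ | exact: ltW].
apply: Wcon.
- by exists x; split=> //; apply/coarse_joined_refl/WZ.
- exists (thicken B s); first exact: open_thicken.
  apply/seteqP; split=> u; last by move=> [Wu [b Bb bu]]; apply: near bu.
  by move=> Bu; split; [case: Bu | exists u; rewrite // mdistxx].
- exists (~` thicken (W `\` B) s).
    by apply: open_closedC; exact: open_thicken.
  apply/seteqP; split=> u.
    move=> Bu; split; first by case: Bu.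
    move=> [v [Wv Bv] vu]; apply: Bv; apply: near Bu Wv _.
    by rewrite metric_sym.
  move=> [Wu WBu]; apply: contrapT => Bu; apply: WBu; exists u => //.
  by rewrite mdistxx.
Qed.

(* Continuity within a set, in epsilon-delta form because reparametrization and
   gluing are then elementary. *)
Definition cont_on (E : set R) f : Prop := forall t, E t ->
  forall e, 0 < e -> exists2 d, 0 < d &
    forall u, E u -> `|t - u| < d -> mdist (f t) (f u) < e.

Lemma within_cont_on (E : set R) f : {within E, continuous f} <-> cont_on E f.
Proof.
rewrite subspace_continuousP; split=> fc t Et.
  move=> e e0; have /(fc t Et) : nbhs (f t) [set y | mdist (f t) y < e].
    by apply/nbhs_ballP; exists e => //; rewrite ballEmdist.
  rewrite /= /within => /nbhs_ballP[d /= d0 fd]; exists d => // u Eu tu.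
  exact: fd.
move=> V /nbhs_ballP[e /= e0 eV]; have [d d0 fd] := fc t Et e e0.
apply/nbhs_ballP; exists d => // u tu Eu; apply: eV.
by rewrite ballEmdist /=; apply: fd.
Qed.

Lemma cont_on_sub (E E' : set R) f : E' `<=` E -> cont_on E f -> cont_on E' f.
Proof.
by move=> EE fc t /EE Et e /(fc t Et)[d d0 fd]; exists d => // u /EE; apply: fd.
Qed.

Lemma cont_on_eq (E : set R) f g : (forall t, E t -> f t = g t) ->
  cont_on E f -> cont_on E g.
Proof.
move=> fg fc t Et e /(fc t Et)[d d0 fd]; exists d => // u Eu.
by rewrite -!fg//; apply: fd.
Qed.

Lemma cont_on_affine (E E' : set R) f (a b : R) :
  (forall t, E' t -> E (a * t + b)) -> cont_on E f ->
  cont_on E' (fun t => f (a * t + b)).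
Proof.
(* The [+ 1] keeps the denominator positive when [a] is zero. *)
move=> EE fc t /EE Et e /(fc _ Et)[d d0 fd]; exists (d / (`|a| + 1)).
  by rewrite divr_gt0// ltr_wpDl.
move=> u /EE Eu tu; apply: fd => //.
rewrite opprD addrACA subrr addr0 -mulrBr normrM.
apply: le_lt_trans (_ : (`|a| + 1) * `|t - u| < _).
  by rewrite ler_wpM2r// lerDl.
by rewrite mulrC -ltr_pdivlMr// ltr_wpDl.
Qed.

Lemma cont_on_paste (E : set R) f (a : R) :
  cont_on (E `&` [set t | t <= a]) f -> cont_on (E `&` [set t | a <= t]) f ->
  cont_on E f.
Proof.
move=> fl fr t Et e e0; have [ta|ta|ta] := ltgtP t a.
- have [|d d0 fd] := fl t _ e e0; first by split=> //=; exact: ltW.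
  exists (Num.min d (a - t)); first by rewrite lt_min d0 subr_gt0.
  move=> u Eu; rewrite lt_min => /andP[tu]; rewrite distrC => ua.
  apply: fd => //; split=> //=; have := ler_norm (u - t); lra.
- have [|d d0 fd] := fr t _ e e0; first by split=> //=; exact: ltW.
  exists (Num.min d (t - a)); first by rewrite lt_min d0 subr_gt0.
  move=> u Eu; rewrite lt_min => /andP[tu ua].
  apply: fd => //; split=> //=; have := ler_norm (t - u); lra.
- have [|d d0 fd] := fl t _ e e0; first by split=> //=; rewrite ta.
  have [|d' d'0 fd'] := fr t _ e e0; first by split=> //=; rewrite ta.
  exists (Num.min d d'); first by rewrite lt_min d0.
  move=> u Eu; rewrite lt_min => /andP[tu tu'].
  have [ua|ua] := leP u a; first exact: fd.
  by apply: fd' => //; split=> //=; apply: ltW.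
Qed.

Lemma cont_on_within_image (E : set R) f : is_interval E -> cont_on E f ->
  connected (f @` E).
Proof.
move=> /connected_intervalP Econ /within_cont_on.
exact: connected_continuous_connected.
Qed.

Lemma joined_inP Z x y : joined_in Z x y <-> exists gamma : R -> X,
  [/\ cont_on `[0, 1] gamma, gamma 0 = x, gamma 1 = y &
      forall t, 0 <= t <= 1 -> Z (gamma t)].
Proof.
split=> -[gamma [/within_cont_on gc g0 g1 gZ]]; exists gamma; split=> //.
  by move=> t t01; apply: gZ; exists t => //=; rewrite in_itv.
by move=> _ [t /= + <-]; rewrite in_itv => /= t01; apply: gZ.
Qed.

Lemma joined_in_refl Z x : Z x -> joined_in Z x x.
Proof.
move=> Zx; apply/joined_inP; exists (fun=> x); split=> // t _ e e0.
by exists 1 => // u _ _; rewrite mdistxx.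
Qed.

Lemma joined_in_sub Z Z' x y : Z `<=` Z' -> joined_in Z x y -> joined_in Z' x y.
Proof.
move=> ZZ /joined_inP[g [gc g0 g1 gZ]]; apply/joined_inP; exists g.
by split=> // t /gZ /ZZ.
Qed.

Lemma joined_in_trans Z x y z :
  joined_in Z x y -> joined_in Z y z -> joined_in Z x z.
Proof.
move=> /joined_inP[g [gc g0 g1 gZ]] /joined_inP[h [hc h0 h1 hZ]].
(* Each path is run at double speed; the maps [2 * t + 0] and [2 * t + -1] have the shape expected
   by [cont_on_affine]. *)
apply/joined_inP; exists
  (fun t => if t <= 2^-1 then g (2 * t + 0) else h (2 * t + -1)).
have half : 2 * 2^-1 = 1 :> R by rewrite divff.
split.
- apply: (@cont_on_paste _ _ 2^-1).
    apply: (@cont_on_eq _ (fun t => g (2 * t + 0))).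
      by move=> t [_ /= ->].
    apply: cont_on_affine gc => t [] /=; rewrite !in_itv/=; lra.
  apply: (@cont_on_eq _ (fun t => h (2 * t + -1))).
    move=> t [_ /= t2]; case: ifP => // t2'.
    have -> : t = 2^-1 by apply/le_anti; rewrite t2 t2'.
    by rewrite half addrN addr0 h0 g1.
  apply: cont_on_affine hc => t [] /=; rewrite !in_itv/=; lra.
- rewrite /= mulr0 addr0 ifT; first exact: g0.
  by rewrite invr_ge0.
- rewrite /=; rewrite ifF; last by apply/negbTE; rewrite -ltNge; lra.
  by rewrite mulr1 (_ : 2 + -1 = 1) //; lra.
- move=> t t01 /=; case: ifP => [t2|/negbT]; first by apply: gZ; lra.
  by rewrite -ltNge => t2; apply: hZ; lra.
Qed.

Lemma joined_in_coarse Z (s : R) x y : 0 < s ->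
  joined_in Z x y -> coarse_joined Z s x y.
Proof.
move=> s0 /joined_inP[g [gc g0 g1 gZ]].
have gcon := cont_on_within_image (@interval_is_interval _ `[0, 1]) gc.
apply: (connected_coarse_joined gcon) => //.
- by move=> _ [t /= + <-]; rewrite in_itv; apply: gZ.
- by exists 0 => //=; rewrite in_itv /= lexx ler01.
- by exists 1 => //=; rewrite in_itv /= lexx ler01.
Qed.

Lemma cont_on_joined Z f (a b : R) : a <= b -> cont_on `[a, b] f ->
  (forall t, a <= t <= b -> Z (f t)) -> joined_in Z (f a) (f b).
Proof.
move=> ab fc fZ; apply/joined_inP; exists (fun t => f ((b - a) * t + a)).
have abt t : 0 <= t <= 1 -> a <= (b - a) * t + a <= b.
  move=> /andP[t0 t1]; have := mulr_ge0 (_ : 0 <= b - a) t0.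
  have := ler_wpM2l (_ : 0 <= b - a) t1; rewrite subr_ge0 ab; lra.
split.
- by apply: cont_on_affine fc => t /=; rewrite !in_itv; apply: abt.
- by rewrite mulr0 add0r.
- by rewrite mulr1 subrK.
- by move=> t /abt; apply: fZ.
Qed.

End MetricTopology.

(** * Proper rays from sequences of paths *)

Section RayBuilding.
Context {R : realType} {X : metricType R}.

Lemma cont_on_glue (g : nat -> R -> X) (f : R -> X) :
  (forall n, cont_on `[0, 1] (g n)) ->
  (forall n t, n%:R <= t <= n.+1%:R -> f t = g n (t - n%:R)) ->
  cont_on `[0, +oo[ f.
Proof.
move=> gc fg; have fn n : cont_on `[0, n%:R] f.
  elim: n => [|n IH].
    move=> t t0 e e0; exists 1 => // u u0 _.
    suff -> : t = u by rewrite mdistxx.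
    by move: t0 u0; rewrite /= !in_itv/=; lra.
  apply: (@cont_on_paste _ _ _ _ n%:R).
    apply: cont_on_sub IH => t [] /=; rewrite !in_itv/=; lra.
  apply: (@cont_on_eq _ _ _ (fun t => g n (1 * t + - n%:R))).
    move=> t [] /=; rewrite in_itv/= => /andP[_ t1] nt.
    by rewrite mul1r -fg ?nt.
  apply: cont_on_affine (gc n) => t [] /=.
  by rewrite !in_itv/= -[in X in X -> _]natr1; lra.
move=> t; rewrite /= in_itv/= andbT => t0 e e0.
(* Since [t + 1 < n], points within distance [1] of [t] stay in [[0, n]], where continuity is
   already known. *)
pose n := (Num.bound t).+1.
have tn : t + 1 < n%:R by rewrite -natr1 ltrD2r; apply: archi_boundP.
have [|d d0 fd] := fn n t _ e e0; first by rewrite /= in_itv/=; lra.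
exists (Num.min d 1); first by rewrite lt_min d0 ltr01.
move=> u; rewrite /= in_itv/= andbT lt_min => u0 /andP[tu tu1].
apply: fd => //; rewrite /= in_itv/= u0 /=.
have := ler_norm (u - t); rewrite (distrC u); lra.
Qed.

Lemma ray_of_paths (W : nat -> set X) (a : nat -> X) :
  (forall n, joined_in (W n) (a n) (a n.+1)) ->
  exists2 f : R -> X, cont_on `[0, +oo[ f &
    forall n t, n%:R <= t <= n.+1%:R -> W n (f t).
Proof.
move=> aj; have /choice[g gP] n := (joined_inP _ _ _).1 (aj n).
pose f (t : R) := g (Num.trunc t) (t - (Num.trunc t)%:R).
have fE n t : n%:R <= t <= n.+1%:R -> f t = g n (t - n%:R).
  (* At [t = n + 1] the truncation has already jumped, so [f] uses the start of [g n.+1]; this is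
     [a n.+1], the end of [g n]. *)
  move=> /andP[nt]; rewrite le_eqVlt => /orP[/eqP->|tn].
    rewrite /f natrK subrr -natr1 addrAC subrr add0r.
    by have [_ -> _ _] := gP n.+1; have [_ _ -> _] := gP n.
  by rewrite /f (@truncn_def _ _ n)// nt.
exists f; first by apply: (cont_on_glue _ fE) => n; have [] := gP n.
move=> n t ntn; rewrite (fE _ _ ntn); have [_ _ _] := gP n; apply.
by move: ntn; rewrite -natr1; lra.
Qed.

(** The preimage of [K] is closed and contained in some compact interval [[0, n]]. *)
Lemma cont_on_proper (f : R -> X) : cont_on `[0, +oo[ f ->
  (forall K : set X, compact K -> exists n : nat,
    forall t, n%:R <= t -> ~ K (f t)) ->
  exists r : proper_ray X, ray_fun r = f.
Proof.
move=> fc fK; have fcw := (within_cont_on _ _).2 fc.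
suff fp (K : set X) : compact K -> compact (`[0, +oo[ `&` f @^-1` K).
  by exists (ProperRay fcw fp).
move=> cK; have [n nK] := fK K cK.
have Kcl : closed K := compact_closed (@metric_hausdorff _ _) cK.
have /closed_subspaceP[V Vcl VE] :
    closed (f @^-1` K : set (subspace `[0, +oo[)).
  by move/continuous_closedP : fcw; apply.
have fKcl : closed (`[0, +oo[ `&` f @^-1` K).
  by rewrite setIC -VE; apply: closedI => //; exact: interval_closed.
apply: (subclosed_compact fKcl (@segment_compact _ 0 n%:R)) => t [/=].
rewrite !in_itv/= andbT => -> /= Kt.
by rewrite leNgt; apply/negP => /ltW /nK.
Qed.

End RayBuilding.

(** * Threads and proper rays *)

Section EndsOfSpace.
Context {R : realType} {X : qpmet R} (hX : proper_geodesic_compact X).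
Implicit Types (mu : {nonneg R}) (s : {posnum R}) (r : proper_ray X).

Definition converges s (A : ends_at X s) r : Prop :=
  forall mu, exists N : nat, r @` `[N%:R, +oo[ `<=` thread A mu.

Lemma compact_thicken (K : set X) : compact K ->
  exists m : {nonneg R}, K `<=` thicken (base X) m%:num.
Proof.
by move=> /compact_metric_bounded Kb; have [c Cc] := base_nonempty X;
  apply: bounded_thicken Cc Kb.
Qed.

Lemma bounded_in_compact (A : set X) : bounded A ->
  exists2 K : set X, compact K & A `<=` K.
Proof.
have [pX _ _] := hX; move=> [M AM].
have [A0|/existsNP[a /contrapT Aa]] := pselect (forall a, ~ A a).
  by exists set0 => [|a /A0//]; exact: compact0.
by exists [set y | mdist a y <= M] => // b Ab; apply: AM.
Qed.

(** With [compact_thicken], this makes compact sets and neighbourhoods of the base cofinal in each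
    other, so escaping either family means the same. *)
Lemma thicken_in_compact (m : R) :
  exists2 K : set X, compact K & thicken (base X) m `<=` K.
Proof.
have [_ _ /compact_metric_bounded[M CM]] := hX; apply: bounded_in_compact.
exists (m + M + m) => x y [c Cc cx] [c' Cc' cy].
have := metric_triangle x c y; have := metric_triangle c c' y.
have := CM _ _ Cc Cc'; rewrite (metric_sym x c); lra.
Qed.

Lemma ray_escapes r (K : set X) : compact K ->
  exists N : nat, forall t, N%:R <= t -> ~ K (r t).
Proof.
move=> /(@ray_proper _ _ r)/compact_exhaust cK.
have [|n m nm t /=|t /= _|N NK] := cK (fun n => [set t | t < n%:R]).
- by move=> n; exact: open_lt.
- by move=> /lt_le_trans; apply; rewrite ler_nat.
- exists (Num.bound `|t|) => //=; apply: le_lt_trans (ler_norm _) _.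
  exact: archi_boundP.
- exists N => t Nt Kt; have /NK /= : (`[0, +oo[ `&` ray_fun r @^-1` K) t.
    by split=> //=; rewrite in_itv/= andbT (le_trans _ Nt).
  by rewrite ltNge Nt.
Qed.

Lemma ray_away r (m : R) :
  exists N : nat, forall t, N%:R <= t -> away m (r t).
Proof.
have [K cK CK] := thicken_in_compact m; have [N NK] := ray_escapes r cK.
by exists N => t /NK; apply: contra_not => /CK.
Qed.

Lemma ray_cont_on r (n : nat) : cont_on `[n%:R, +oo[ r.
Proof.
have /within_cont_on := @ray_continuous _ _ r.
by apply: cont_on_sub => t; rewrite /= !in_itv/= !andbT; apply: le_trans.
Qed.

Lemma ray_image_connected r (n : nat) : connected (r @` `[n%:R, +oo[).
Proof.
exact: cont_on_within_image (@interval_is_interval _ _) (@ray_cont_on r n).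
Qed.

Lemma ray_image_unbounded r (n : nat) : ~ bounded (r @` `[n%:R, +oo[).
Proof.
move=> /bounded_in_compact[K cK rK]; have [N NK] := ray_escapes r cK.
apply: (NK (Num.max N%:R n%:R)); first by rewrite le_max lexx.
by apply: rK; exists (Num.max N%:R n%:R) => //=;
  rewrite in_itv/= andbT le_max lexx orbT.
Qed.

(** The seeds are tails of the ray: they are connected, hence coarsely joined at any scale,
    unbounded by properness, and any two of them meet. *)
Lemma ray_thread s r : exists A : ends_at X s, converges A r.
Proof.
have /choice[N NP] mu :
    exists N : nat, forall t, N%:R <= t -> away mu%:num (r t).
  exact: ray_away.
pose W mu := r @` `[(N mu)%:R, +oo[.
have WZ mu : W mu `<=` away mu%:num.
  by move=> _ [t /= + <-]; rewrite in_itv/= andbT; apply: NP.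
have Wj mu x y : W mu x -> W mu y -> coarse_joined (away mu%:num) s%:num x y.
  by apply: connected_coarse_joined; [exact: ray_image_connected|exact: WZ|].
have [mu|mu x y|mu mu' _|A WA] := @thread_of_seeds _ _ s W.
- exact: ray_image_unbounded.
- exact: Wj.
- pose t := Num.max (N mu)%:R (N mu')%:R : R.
  have Wt : W mu (r t).
    by exists t => //=; rewrite in_itv/= andbT le_max lexx.
  exists (r t), (r t); split=> //; last exact: Wj.
  by exists t => //=; rewrite in_itv/= andbT le_max lexx orbT.
by exists A => mu; exists (N mu); apply: WA.
Qed.

(** Each step is filled by a geodesic whose points are within [s] of its starting point; this is the
    loss of [s] in the radius. *)
Lemma coarse_joined_path (m : R) s (x y : X) :
  coarse_joined (away (m + s%:num)) s%:num x y ->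
  joined_in (coarse_component (away m) s%:num x) x y.
Proof.
(* [J] also records the coarse joining, which moves a path found in the component of [b] into the
   component of [a]. *)
have [_ gX _] := hX; pose J (x y : X) := coarse_joined (away m) s%:num x y /\
  joined_in (coarse_component (away m) s%:num x) x y.
have sub (a : X) : away (m + s%:num) a -> away m a.
  by apply: away_le; rewrite lerDl.
suff JP : forall x y, coarse_joined (away (m + s%:num)) s%:num x y -> J x y.
  by move=> /JP[].
apply: coarse_joined_ind =>
  [a /sub Za|a b c [ab abj] [bc bcj]|a b Za /sub Zb ab].
- split; first exact: coarse_joined_refl.
  by apply: joined_in_refl; apply: coarse_joined_refl.
- split; first exact: coarse_joined_trans bc.
  apply: joined_in_trans abj _; apply: joined_in_sub bcj => z.
  exact: coarse_joined_trans.
- split; first by apply: coarse_joined_step => //; apply: sub.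
  have [gamma [g0 g1 gd]] := gX a b.
  have gs t : 0 <= t <= mdist a b -> mdist a (gamma t) <= s%:num.
    move=> /andP[t0 tab]; rewrite -g0 gd ?lexx ?mdist_ge0 ?t0//.
    by rewrite sub0r normrN ger0_norm// (le_trans tab).
  rewrite -[in X in joined_in _ X]g0 -[in X in joined_in _ _ X]g1.
  apply: cont_on_joined => [||t t01]; first exact: mdist_ge0.
    move=> t /= + e e0; rewrite in_itv/= => tab; exists e => // u.
    by rewrite in_itv/= => uab tu; rewrite gd.
  apply: coarse_joined_step; [exact: sub| |exact: gs].
  apply/awayP => c Cc; have := gs _ t01; have := (awayP _ _).1 Za c Cc.
  have := metric_triangle c (gamma t) a; rewrite (metric_sym a); lra.
Qed.

(** Points [a n] are chosen at level [n + s], so that consecutive ones are joined by a path inside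
    the component at level [n]; the ray follows this path during [[n, n + 1]]. *)
Lemma thread_ray s (A : ends_at X s) : exists r, converges A r.
Proof.
have n0 (n : nat) : 0 <= n%:R :> R by [].
have ns0 (n : nat) : 0 <= n%:R + s%:num :> R by rewrite addr_ge0.
have /choice[a aA] n := thread_nonempty A (NngNum (ns0 n)).
have [n|f fc fA] := @ray_of_paths _ _ (fun n => thread A (NngNum (n0 n))) a.
  have Aa : thread A (NngNum (n0 n)) (a n).
    by apply: thread_le (aA n); rewrite /= lerDl.
  rewrite (unbounded_component_eq (thread_component A _) Aa).
  apply: coarse_joined_path.
  have := thread_joined (a n.+1) (aA n); rewrite /= => <-.
  by apply: thread_le (aA n.+1); rewrite /= lerD2r ler_nat.
have fN mu : exists N : nat, forall t, N%:R <= t -> thread A mu (f t).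
  exists (Num.bound mu%:num) => t Nt.
  have t0 : 0 <= t by rewrite (le_trans _ Nt).
  have tt : (Num.trunc t)%:R <= t <= (Num.trunc t).+1%:R.
    by have /andP[-> /ltW ->] := truncn_itv t0.
  apply: thread_le (fA _ _ tt) => /=.
  apply: le_trans (ltW (archi_boundP (ge0 mu))) _.
  by rewrite ler_nat truncn_ge_nat.
have [K|r rf] := cont_on_proper fc.
  move=> /compact_thicken[m Km]; have [N NA] := fN m.
  by exists N => t /NA /thread_away; apply: contra_not => /Km.
exists r => mu; have [N NA] := fN mu; exists N => _ [t /= + <-].
by rewrite in_itv/= andbT rf; apply: NA.
Qed.

(** Beyond level [m + k], where [K] lies within [m] of the base, a [k]-chain between the two rays is
    filled by geodesics that still avoid [K]; each tail is joined to its starting point along the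
    ray itself. *)
Lemma converges_eq s s' (A : ends_at X s) (A' : ends_at X s') r r' :
  fend A = fend A' -> converges A r -> converges A' r' -> ray_eq r r'.
Proof.
move=> /fend_eqP[k [_ s'k AA]] Ar Ar' K cK; have [m Km] := compact_thicken cK.
have mk0 : 0 <= m%:num + k%:num by rewrite addr_ge0.
have [N rN] := Ar (NngNum mk0); have [N' rN'] := Ar' (NngNum mk0).
have mkK x : away (m%:num + k%:num) x -> (~` K) x.
  by move=> ax /Km; have: away m%:num x by apply: away_le ax; rewrite lerDl.
pose M := maxn N N'.
have rA t : M%:R <= t -> thread A (NngNum mk0) (r t).
  move=> Mt; apply: rN; exists t => //=; rewrite in_itv/= andbT.
  by apply: le_trans Mt; rewrite ler_nat leq_maxl.
have rA' t : M%:R <= t -> thread A' (NngNum mk0) (r' t).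
  move=> Mt; apply: rN'; exists t => //=; rewrite in_itv/= andbT.
  by apply: le_trans Mt; rewrite ler_nat leq_maxr.
have joined (q : proper_ray X) t : (forall u, M%:R <= u -> (~` K) (q u)) ->
    M%:R <= t -> joined_in (~` K) (q M%:R) (q t).
  move=> qK Mt; apply: cont_on_joined => //.
    apply: cont_on_sub (@ray_cont_on q M) => u /=.
    by rewrite !in_itv/= => /andP[->].
  by move=> u /andP[/qK].
exists M, (r M%:R); split; first by apply/mkK/(thread_away (rA _ _)).
  move=> _ [t /= + <-]; rewrite in_itv/= andbT; apply: joined => u /rA.
  by move=> /thread_away /mkK.
move=> _ [t /= + <-]; rewrite in_itv/= andbT => Mt.
apply: (@joined_in_trans _ _ _ _ (r' M%:R)); last first.
  by apply: joined Mt => u /rA' /thread_away /mkK.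
have := AA _ _ _ (rA _ (lexx _)) (rA' _ (lexx _)) => /coarse_joined_path.
by apply: joined_in_sub => z Cz /Km; have [_] := coarse_joined_mem Cz.
Qed.

(** A path avoiding a compact set that contains the [mu]-neighbourhood of the base is coarsely
    joined away from the base at every scale, so the tail of [r'] falls into the component entered
    by [r]. *)
Lemma ray_eq_converges s (A : ends_at X s) r r' :
  ray_eq r r' -> converges A r -> converges A r'.
Proof.
move=> rr Ar mu; have [K cK CK] := thicken_in_compact mu%:num.
have KZ : ~` K `<=` away mu%:num by apply: subsetC.
have [N [x [Kx xr xr']]] := rr K cK; have [N' rN'] := Ar mu.
exists N => _ [t /= + <-]; rewrite in_itv/= andbT => Nt.
pose u : R := Num.max N%:R N'%:R.
have Au : thread A mu (r u).
  by apply: rN'; exists u => //=; rewrite in_itv/= andbT le_max lexx orbT.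
have xu : joined_in (~` K) x (r u).
  by apply: xr; exists u => //=; rewrite in_itv/= andbT le_max lexx.
have xt : joined_in (~` K) x (r' t).
  by apply: xr'; exists t => //=; rewrite in_itv/= andbT.
have coarse z : joined_in (~` K) x z -> coarse_joined (away mu%:num) s%:num x z.
  by move=> /(joined_in_sub KZ)/(joined_in_coarse (gt0 s)).
apply/(thread_joined _ Au); apply: coarse_joined_trans (coarse _ xt).
exact/coarse_joined_sym/coarse.
Qed.

Lemma converges_same s s' (A : ends_at X s) (A' : ends_at X s') r :
  converges A r -> converges A' r -> fend A = fend A'.
Proof.
move=> Ar Ar'; apply: (@fend_eq _ _ s%:num) => mu.
have [N rN] := Ar mu; have [N' rN'] := Ar' mu.
pose t : R := Num.max N%:R N'%:R.
have At : thread A mu (r t).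
  by apply: rN; exists t => //=; rewrite in_itv/= andbT le_max lexx.
exists (r t), (r t); split=> //.
  by apply: rN'; exists t => //=; rewrite in_itv/= andbT le_max lexx orbT.
exact: coarse_joined_refl (thread_away At).
Qed.

(** That [ray_eq] is an equivalence relation is read off threads: equivalent rays converge along a
    common thread of scale [1]. *)
Lemma end_of_eq r r' : end_of r = end_of r' <-> ray_eq r r'.
Proof.
have conv (q q' : proper_ray X) : ray_eq q q' -> exists A : ends_at X 1%:pos,
    converges A q /\ converges A q'.
  move=> qq; have [A Aq] := ray_thread 1%:pos q; exists A.
  by split=> //; apply: ray_eq_converges qq Aq.
have sym (q q' : proper_ray X) : ray_eq q q' -> ray_eq q' q.
  by move=> qq; have [A [Aq Aq']] := conv _ _ qq; apply: converges_eq Aq' Aq.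
have trans (q q' q'' : proper_ray X) :
    ray_eq q q' -> ray_eq q' q'' -> ray_eq q q''.
  move=> qq q'q; have [A [Aq Aq']] := conv _ _ qq.
  exact: converges_eq Aq (ray_eq_converges q'q Aq').
split=> [/(congr1 (fun c => sval c r'))/= ->|rr].
  by have [A Ar] := ray_thread 1%:pos r'; exact: (converges_eq erefl Ar Ar).
apply/eq_exist/seteqP; split=> q /=.
  exact: trans (sym _ _ rr).
exact: trans rr.
Qed.

Lemma end_limit_exists (x : filtered_ends X) : exists r,
  forall s (A : ends_at X s), x = fend A -> converges A r.
Proof.
have [s [A ->]] := fendP x; have [r Ar] := thread_ray A; exists r.
move=> s' A' AA; have [r' Ar'] := thread_ray A'.
exact: ray_eq_converges (converges_eq (esym AA) Ar' Ar) Ar'.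
Qed.

Definition end_limit (x : filtered_ends X) : ends X :=
  end_of (sval (cid (end_limit_exists x))).

Lemma end_limitP s (A : ends_at X s) r :
  end_limit (fend A) = end_of r <-> converges A r.
Proof.
rewrite /end_limit; case: cid => /= q /(_ _ A erefl) Aq.
rewrite end_of_eq; split=> [qr|]; first exact: ray_eq_converges qr Aq.
exact: converges_eq Aq.
Qed.

Lemma end_limit_bij : bijective end_limit.
Proof.
rewrite -setTT_bijective; split=> //.
- move=> x y _ _; have [s [A ->]] := fendP x; have [s' [B ->]] := fendP y.
  have [r Ar] := thread_ray A; rewrite ((end_limitP _ _).2 Ar) => /esym.
  by move=> /end_limitP; apply: converges_same.
- move=> e _; case: e => c [r cE]; have [A Ar] := ray_thread 1%:pos r.
  exists (fend A) => //; rewrite ((end_limitP _ _).2 Ar).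
  by rewrite /end_of/class_of; apply/eq_exist.
Qed.

End EndsOfSpace.

(** The composite of [f] with a ray need not be continuous, so the image end is represented by a ray
    [r'] at bounded distance from it; a single step of length at most [K] then links the two threads
    at each level. *)
Lemma end_limit_natural (R : realType) (X Y : qpmet R)
    (hX : proper_geodesic_compact X) (hY : proper_geodesic_compact Y)
    (f : qpmor X Y) (x : filtered_ends X) (r : proper_ray X)
    (r' : proper_ray Y) (K : R) :
  (forall t, 0 <= t -> mdist (f (r t)) (r' t) <= K) ->
  end_limit hX x = end_of r -> end_limit hY (end_map f x) = end_of r'.
Proof.
have [s [A ->]] := fendP x => fK /end_limitP Ar.
have [t [B AB]] := tracks_exists f A; rewrite (end_mapE AB).
have [B' Br'] := ray_thread hY 1%:pos r'.
suff -> : fend B = fend B' by apply/end_limitP.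
apply: (@fend_eq _ _ K) => nu; have [mu fA] := AB nu.
have [N rN] := Ar mu; have [N' rN'] := Br' nu.
pose u : R := Num.max N%:R N'%:R.
have Bu : thread B nu (f (r u)).
  apply: fA; exists (r u) => //; apply: rN; exists u => //=.
  by rewrite in_itv/= andbT le_max lexx.
have Bu' : thread B' nu (r' u).
  by apply: rN'; exists u => //=; rewrite in_itv/= andbT le_max lexx orbT.
exists (f (r u)), (r' u); split=> //; apply: coarse_joined_step.
- exact: thread_away Bu.
- exact: thread_away Bu'.
- by apply: fK; rewrite le_max ler0n.
Qed.

(** * Comparison with coends *)

Lemma nonexpansive_continuous (R : realType) (X Y : metricType R) (f : X -> Y) :
  (forall x y, mdist (f x) (f y) <= mdist x y) -> continuous f.
Proof.
move=> f1 x V /nbhs_ballP[e /= e0 eV]; apply/nbhs_ballP; exists e => // y.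
rewrite ballEmdist /= => xy; apply: eV; rewrite ballEmdist /=.
exact: le_lt_trans (f1 _ _) xy.
Qed.

Lemma cont_on_compact_image (R : realType) (X : metricType R) (E : set R)
    (f : R -> X) : compact E -> cont_on E f -> compact (f @` E).
Proof. by move=> cE /within_cont_on fc; apply: continuous_compact. Qed.

(** A filter on the subtype is pushed forward along the inclusion; its cluster point in [K] lifts
    back because [K] lies in [A]. *)
Lemma compact_subtype (X : topologicalType) (A K : set X) : K `<=` A ->
  compact K -> compact (set_val @^-1` K : set A).
Proof.
move=> KA cK F FF FK.
have FvK : (set_val @ F) K by exact: FK.
have [x [Kx xF]] := cK _ (fmap_proper_filter _ FF) FvK.
pose y : A := SigSub (mem_set (KA _ Kx)).
have yE : set_val y = x by [].
exists y; split; first by rewrite /= yE.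
move=> B N FB; rewrite nbhsE => -[V [[W Wo WV] Vy] VN].
pose vB := [set z | exists2 b : A, B b & set_val b = z].
have FBv : (set_val @ F) vB.
  by change (F (set_val @^-1` vB)); apply: filterS FB => b Bb; exists b.
have Wx : nbhs x W.
  by apply: open_nbhs_nbhs; split=> //; move: Vy; rewrite -WV /= yE.
have [_ [[b Bb <-] Wb]] := xF _ _ FBv Wx.
by exists b; split=> //; apply: VN; rewrite -WV.
Qed.

(** * Edges, paths and translations in the Cayley graph *)

Section CayleyComplex.
Context {R : realType} {G : groupType} {S : seq G} (genS : generating S).
Notation X := (cayley R genS).
Implicit Types (p q : X) (v w g : G).

(** The retraction of the line onto the unit interval; it turns the parametrization of an edge into
    a total function [edge_pt] that does not increase distances. *)
Definition clamp (t : R) : R := if t <= 0 then 0 else if t <= 1 then t else 1.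

Lemma clamp01 t : 0 <= clamp t <= 1.
Proof. by rewrite /clamp; case: (leP t 0) => ?; case: (leP t 1) => ?; lra. Qed.

Lemma clamp_id t : 0 <= t <= 1 -> clamp t = t.
Proof.
by rewrite /clamp; case: (leP t 0) => ?; case: (leP t 1) => ? /andP[? ?]; lra.
Qed.

Lemma clamp_nonexpansive s t : `|clamp s - clamp t| <= `|s - t|.
Proof.
rewrite /clamp; case: (leP s 0) => ?; case: (leP t 0) => ?;
  case: (leP s 1) => ?; case: (leP t 1) => ?;
  rewrite ler_norml; case: (ger0P (s - t)) => ?; lra.
Qed.

Lemma edge_pt_subproof v w (vw : cell S v w) (t : R) :
  exists (v' w' : G) (t' : R), [/\ cell S v' w', 0 <= t' <= 1 &
    edge_point v w (clamp t) = edge_point v' w' t'].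
Proof. by exists v, w, (clamp t); rewrite clamp01. Qed.

Definition edge_pt v w (vw : cell S v w) (t : R) : X :=
  exist _ (edge_point v w (clamp t)) (edge_pt_subproof vw t).

Lemma edge_ptE v w (vw : cell S v w) p t : 0 <= t <= 1 ->
  sval p = edge_point v w t -> p = edge_pt vw t.
Proof. by move=> t01 pE; apply: cayley_eq; rewrite pE /= clamp_id. Qed.

Lemma edge_pt_nonexpansive v w (vw : cell S v w) s t :
  mdist (edge_pt vw s) (edge_pt vw t) <= `|s - t|.
Proof.
have [vwE|vwa] := vw.
  suff -> : edge_pt vw s = edge_pt vw t by rewrite mdistxx.
  by apply: cayley_eq; rewrite /= -vwE !(edge_pointxx genS).
apply: le_trans (clamp_nonexpansive s t); apply: path_dist_le.
apply: polygonal_segment; exists v, w, (clamp s), (clamp t).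
by rewrite !clamp01.
Qed.

Lemma edge_pt_cont v w (vw : cell S v w) (E : set R) : cont_on E (edge_pt vw).
Proof.
move=> t _ e e0; exists e => // u _ tu.
exact: le_lt_trans (edge_pt_nonexpansive _ _ _) tu.
Qed.

Lemma closed_cell_image v w (vw : cell S v w) :
  closed_cell v w = edge_pt vw @` `[0, 1].
Proof.
apply/seteqP; split=> p.
  by move=> [t t01 pE]; exists t; rewrite ?(edge_ptE vw t01 pE)//= in_itv.
by move=> [t /=]; rewrite in_itv => t01 <-; exists t; rewrite //= clamp_id.
Qed.

Lemma closed_cell_compact v w :
  cell S v w -> compact (@closed_cell R G S genS v w).
Proof.
move=> vw; rewrite (closed_cell_image vw).
apply: cont_on_compact_image; [exact: segment_compact|exact: edge_pt_cont].
Qed.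

Lemma closed_cell_connected v w :
  cell S v w -> connected (@closed_cell R G S genS v w).
Proof.
move=> vw; rewrite (closed_cell_image vw).
exact: cont_on_within_image (@interval_is_interval _ _)
    (@edge_pt_cont _ _ _ _).
Qed.

Lemma closed_cell_l v w : closed_cell v w (vertex R genS v).
Proof. by exists 0; rewrite ?lexx ?ler01// (edge_point0 genS). Qed.

Lemma closed_cell_r v w : closed_cell v w (vertex R genS w).
Proof. by exists 1; rewrite ?lexx ?ler01// (edge_point1 genS). Qed.

(** [W] is the union of the pieces of edges traversed; a piece is the image of the interval between
    its two parameters, so its points are no further from its start than its length. *)
Lemma polygonal_connected p q l : polygonal p q l -> 0 <= l /\
  exists W, [/\ connected W, W p, W q & forall z, W z -> mdist p z <= l].
Proof.
elim=> [|q' r l1 l2 pq [l10 [W [Wc Wp Wq WP]]] [v [w [t [u]]]]].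
  split=> //; exists [set p]; split=> // [|z ->].
    exact: connected1.
  by rewrite mdistxx.
move=> [vwa t01 u01 [q'E rE] ->].
have vw : cell S v w by right.
split; first by rewrite addr_ge0.
pose W' := edge_pt vw @` `[Num.min t u, Num.max t u].
have W'q : W' q'.
  exists t; last by rewrite (edge_ptE vw t01 q'E).
  by rewrite /= in_itv /= ge_min le_max lexx.
have W'r : W' r.
  exists u; last by rewrite (edge_ptE vw u01 rE).
  by rewrite /= in_itv /= ge_min le_max lexx !orbT.
exists (W `|` W'); split.
- apply: connectedU => //; first by exists q'.
  exact: cont_on_within_image (@interval_is_interval _ _)
    (@edge_pt_cont _ _ _ _).
- by left.
- by right.
- move=> z [/WP|].
    by move=> /le_trans; apply; rewrite lerDl.
  move=> [x /= + <-]; rewrite in_itv/= => xtu.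
  apply: le_trans (metric_triangle p q' _) _; apply: lerD.
    apply: path_dist_le pq.
  rewrite (edge_ptE vw t01 q'E).
  apply: le_trans (edge_pt_nonexpansive _ _ _) _.
  by move: xtu; case: (leP t u) => ?; case: (ger0P (t - x)) => ?;
    case: (ger0P (t - u)) => ?; lra.
Qed.

Lemma close_connected p q (l : R) : mdist p q < l -> exists W,
  [/\ connected W, W p, W q & forall z, W z -> mdist p z < l].
Proof.
move=> /(inf_lt (polygonal_nonempty p q))[l' /polygonal_connected[_ []]].
move=> W [Wc Wp Wq WP] l'l; exists W; split=> // z /WP.
by move=> /le_lt_trans; apply.
Qed.

Lemma translate_vertex g v :
  translate g (vertex R genS v) = vertex R genS (g * v)%g.
Proof.
apply: cayley_eq; apply/funext => u; rewrite /= /edge_point.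
by rewrite -!(inj_eq (mulgI g) (g^-1 * u)%g) !mulVKg.
Qed.

Lemma translate_polygonal g p q l :
  polygonal p q l -> polygonal (translate g p) (translate g q) l.
Proof.
elim=> [|q' r l1 l2 _ IH [v [w [t [u [[s sS vws] t01 u01 [qE rE] ->]]]]]].
  by left.
apply: polygonal_step IH _; exists (g * v)%g, (g * w)%g, t, u; split=> //.
  by exists s => //; case: vws => ->; [left|right]; rewrite mulgA.
by split; apply/funext => x; rewrite /= ?qE ?rE /edge_point;
  rewrite -!(inj_eq (mulgI g) (g^-1 * x)%g) !mulVKg.
Qed.

Lemma translate_nonexpansive g p q :
  mdist (translate g p) (translate g q) <= mdist p q.
Proof.
apply: lb_le_inf; first exact: polygonal_nonempty.
by move=> l /(translate_polygonal g)/path_dist_le.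
Qed.

Lemma translateK g p : translate (g^-1)%g (translate g p) = p.
Proof. by rewrite -translateM mulVg translate1. Qed.

Lemma translate_connected g (W : set X) :
  connected W -> connected (translate g @` W).
Proof.
move=> Wc; apply: connected_continuous_connected Wc _.
apply: continuous_subspaceT; apply: nonexpansive_continuous.
exact: translate_nonexpansive.
Qed.

Lemma translate_closed_cell g v w p :
  closed_cell v w p -> closed_cell (g * v)%g (g * w)%g (translate g p).
Proof.
move=> [t t01 pE]; exists t => //; apply/funext => x; rewrite /= pE /edge_point.
by rewrite -!(inj_eq (mulgI g) (g^-1 * x)%g) !mulVKg.
Qed.

End CayleyComplex.

(** * The orbit map and compactness of orbit spaces *)

Section OrbitMap.
Local Open Scope quotient_scope.
Context {R : realType} {G : groupType} {S : seq G} {genS : generating S}.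
Context (P : groupClosed G) (A : set (cayley R genS)).
Notation Q := {eq_quot same_orbit_equiv P A}.
Notation QT := (quotient_topology {eq_quot same_orbit_equiv P A}).

Definition orbit_of (x : A) : orbit_space P A := \pi_QT x.
Definition orbit_rep (y : orbit_space P A) : A := repr (y : Q).

Lemma orbit_repK (y : orbit_space P A) : orbit_of (orbit_rep y) = y.
Proof. by rewrite /orbit_of /orbit_rep; exact: (@reprK _ Q). Qed.

Lemma orbit_ofP x y : orbit_of x = orbit_of y <-> same_orbit P x y.
Proof.
have e : reflect (\pi_Q x = \pi_Q y) (same_orbit_equiv P A x y).
  exact: eqquotP.
by split=> /e.
Qed.

Lemma orbit_of_continuous : continuous orbit_of.
Proof. exact: pi_continuous. Qed.

Lemma orbit_open (U : set (orbit_space P A)) :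
  open U <-> open (orbit_of @^-1` U).
Proof. by []. Qed.
End OrbitMap.


Section OrbitSpaces.
Context {R : realType} {G : groupType} {S : seq G} (genS : generating S).
Context (P : groupClosed G).
Notation X := (cayley R genS).
Notation XP := (cayley_pair R genS P).
Implicit Types (p q : X) (v w g : G) (A K : set X).

Lemma thicken_translate (m : R) g p : g \in P ->
  thicken (base XP) m p -> thicken (base XP) m (translate g p).
Proof.
move=> gP [_ [h hP <-] hp]; exists (vertex R genS (g * h)%g).
  by exists (g * h)%g => //=; apply: gpredM.
rewrite -translate_vertex; exact: le_lt_trans (translate_nonexpansive _ _ _) hp.
Qed.

(** The orbits of points at distance less than [n] from [P] form an increasing open cover of the
    compact orbit space. *)
Lemma cocompact_thicken A : compact [set: orbit_space P A] ->
  exists n : nat, A `<=` thicken (base XP) n%:R.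
Proof.
move=> cA; pose U n : set (orbit_space P A) :=
  [set x | thicken (base XP) n%:R (set_val (orbit_rep x) : XP)].
(* [U n] is defined through chosen representatives, but translation by [P] preserves the
   neighbourhoods of the base, so any point of the orbit may be tested. *)
have UE n (x : A) : U n (orbit_of P x) <->
    thicken (base XP) n%:R (set_val x : XP).
  have /orbit_ofP : orbit_of P (orbit_rep (orbit_of P x)) = orbit_of P x.
    exact: orbit_repK.
  rewrite /U /=; move: (orbit_rep _) => y /asboolP[g gP gyx].
  split=> [/(thicken_translate gP)|Ux]; first by rewrite set_valE gyx.
  rewrite -(translateK g (set_val y)) set_valE gyx.
  by apply: thicken_translate; rewrite ?gpredV.
have [n|n m nm x|x _|n AU] := compact_exhaust cA (U := U).
- apply/orbit_open.
  exists (thicken (base XP) n%:R); first exact: open_thicken.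
  by apply/seteqP; split=> x /UE.
- move=> [c Cc cx]; exists c => //; apply: lt_le_trans cx _.
  by rewrite ler_nat.
- have [c Cc] := base_nonempty XP.
  exists (Num.bound (mdist c (set_val (orbit_rep x) : XP))) => //.
  by exists c => //; apply: archi_boundP; exact: mdist_ge0.
- exists n => p Ap; pose x : A := SigSub (mem_set Ap).
  by have /UE : U n (orbit_of P x) by apply: AU.
Qed.

(** The orbit map is continuous, and its restriction to [K] is onto because every orbit meets
    [K]. *)
Lemma orbit_space_compact A K : K `<=` A -> compact K ->
  (forall p, A p -> exists2 g, g \in P & K (translate g p)) ->
  compact [set: orbit_space P A].
Proof.
move=> KA cK KP; have cK' := compact_subtype KA cK.
suff -> : [set: orbit_space P A] = @orbit_of _ _ _ _ P A @` (set_val @^-1` K).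
  apply: continuous_compact cK'; apply: continuous_subspaceT.
  exact: orbit_of_continuous.
apply/seteqP; split=> // x _; have [g gP Kx] := KP _ (set_valP (orbit_rep x)).
exists (SigSub (mem_set (KA _ Kx))) => //.
rewrite -[RHS]orbit_repK; apply/orbit_ofP; rewrite same_orbit_sym.
by apply/asboolP; exists g.
Qed.

End OrbitSpaces.

(** * The exhaustion by subgraphs spanned by balls around the subgroup *)

Section Exhaustion.
Context {R : realType} {G : groupType} {S : seq G} (genS : generating S).
Context (P : groupClosed G).
Notation X := (cayley R genS).
Notation XP := (cayley_pair R genS P).
Implicit Types (p q : X) (v w g : G) (A K : set X) (L : seq G).

Lemma adjacent_sym v w : adjacent S v w -> adjacent S w v.
Proof. by move=> [s sS [|] wE]; exists s => //; [right|left]. Qed.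

Lemma cell_mull g v w : cell S v w -> cell S (g * v)%g (g * w)%g.
Proof.
move=> [->|[s sS vw]]; first by left.
by right; exists s => //; case: vw => ->; [left|right]; rewrite mulgA.
Qed.

Definition neighbors L : seq G :=
  L ++ [seq (u * s)%g | u <- L, s <- S] ++ [seq (u * s^-1)%g | u <- L, s <- S].

Lemma neighborsP L v w : v \in L -> cell S v w -> w \in neighbors L.
Proof.
move=> vL; rewrite !mem_cat => -[<-|[s sS [->|vE]]]; first by rewrite vL.
  by rewrite allpairs_f ?orbT.
by rewrite -(mulgK s w) -vE (allpairs_f (fun u s => u * s^-1)%g) ?orbT.
Qed.

(** The vertices at word distance at most [n] from [P]. *)
Fixpoint coset_ball (n : nat) : set G :=
  if n is m.+1 then
    coset_ball m `|` [set w | exists2 v, coset_ball m v & adjacent S v w]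
  else [set g | g \in P].

Lemma coset_ball_le n m : (n <= m)%N -> coset_ball n `<=` coset_ball m.
Proof.
elim: m => [|m IH]; first by rewrite leqn0 => /eqP->.
rewrite leq_eqVlt => /orP[/eqP->//|]; rewrite ltnS => /IH nm.
by apply: subset_trans nm _ => v; left.
Qed.

Lemma coset_ball_cell n v w : coset_ball n v -> cell S v w -> coset_ball n.+1 w.
Proof. by move=> vn [<-|vw]; [left|right; exists v]. Qed.

Lemma coset_ball_mull n g v :
  g \in P -> coset_ball n v -> coset_ball n (g * v)%g.
Proof.
move=> gP; elim: n v => [|n IH] v /=; first exact: gpredM.
move=> [/IH|[u /IH un uv]]; first by left.
by apply: coset_ball_cell un _; apply: cell_mull; right.
Qed.

(** The ball is finite modulo [P]: since left multiplication preserves adjacency, passing to radius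
    [n + 1] only adds neighbours of the finitely many representatives. *)
Lemma coset_ball_finite n : exists L, forall v, coset_ball n v ->
  exists2 g, g \in P & (g * v)%g \in L.
Proof.
elim: n => [|n [L LP]].
  exists [:: 1%g] => v vP; exists (v^-1)%g; first by rewrite gpredV.
  by rewrite mulVg mem_head.
exists (neighbors L) => v vn.
have [u un uv] : exists2 u, coset_ball n u & cell S u v.
  by case: vn => [vn|[u un uv]]; [exists v => //; left|exists u => //; right].
have [g gP gL] := LP _ un; exists g => //.
by apply: neighborsP gL _; apply: cell_mull.
Qed.

Definition ball_graph (n : nat) : set X := [set p | exists v w,
  [/\ coset_ball n v, coset_ball n w, cell S v w & closed_cell v w p]].

Lemma ball_graph_cell n v w : coset_ball n v -> coset_ball n w -> cell S v w ->
  closed_cell v w `<=` ball_graph n.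
Proof. by move=> vn wn vw p vwp; exists v, w. Qed.

Lemma edge_point_swap v w (t : R) : edge_point v w t = edge_point w v (1 - t).
Proof. by apply/funext => u; rewrite /edge_point; ring. Qed.

(* The word distance to P of a vertex v in the support of a point q is at most
   the length of a path from P to q plus the distance 1 - q v from q to v. *)
Lemma polygonal_coset_ball g q (l : R) :
  g \in P -> polygonal (vertex R genS g) q l ->
  forall v, 0 < sval q v -> exists2 n, coset_ball n v &
    n%:R <= l + (1 - sval q v).
Proof.
move=> gP.
have key v w (t u m : R) : adjacent S v w -> v != w -> 0 <= t <= 1 ->
    0 <= u <= 1 ->
    (forall x, 0 < edge_point v w t x -> exists2 n, coset_ball n x &
      n%:R <= m + (1 - edge_point v w t x)) ->
    exists2 n, coset_ball n v & n%:R <= m + `|t - u| + (1 - edge_point v w u v).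
  move=> vw nvw t01 u01 IH.
  have ev y : edge_point v w y v = 1 - y.
    by rewrite /edge_point eqxx (negbTE nvw) mulr1 mulr0 addr0.
  have ew : edge_point v w t w = t.
    by rewrite /edge_point eqxx eq_sym (negbTE nvw) mulr1 mulr0 add0r.
  have := ler_norm (t - u); rewrite ev.
  (* If [t < 1], then [v] is already in the support of the previous point. Otherwise that point is
     the vertex [w], and [v] is one edge further. *)
  have [t1|t1] := ltP t 1.
    by have [|n vn] := IH v; rewrite ev ?subr_gt0// => nl; exists n => //; lra.
  have [|n wn] := IH w; rewrite ew; first lra.
  move=> nl ?; exists n.+1; last by rewrite -natr1; lra.
  by apply: coset_ball_cell wn _; right; apply: adjacent_sym.
elim=> [v|q' r l1 l2 _ IH [v [w [t [u [vw t01 u01 [q'E rE] ->]]]]] x].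
  rewrite /= /edge_point subr0 mul1r mul0r addr0.
  have [->|//] := eqVneq v g; last by rewrite ltxx.
  by move=> _; exists 0; rewrite //= subrr addr0.
rewrite q'E in IH; rewrite rE.
have [wE|nvw] := eqVneq v w.
  move: IH; rewrite -wE !(edge_pointxx genS) => IH /IH[n xn nl]; exists n => //.
  by apply: le_trans nl _; rewrite lerD2r lerDl.
have [->|nxv] := eqVneq x v => [_|]; first exact: key.
have [->|nxw] := eqVneq x w => [_|]; last first.
  by rewrite /edge_point (negbTE nxv) (negbTE nxw) !mulr0 addr0 ltxx.
(* The endpoint [w] is reduced to the case of [v] by reversing the edge. *)
rewrite edge_point_swap (_ : t - u = - ((1 - t) - (1 - u))); last by ring.
rewrite normrN; apply: key; rewrite 1?eq_sym//.
- exact: adjacent_sym.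
- lra.
- lra.
- by rewrite -edge_point_swap.
Qed.

(** A vertex in the support of [p] has word distance less than [m + 1] to [P], and the other
    endpoint of the cell is at most one edge further. *)
Lemma thicken_ball_graph (m : R) (n : nat) : m + 2 <= n%:R ->
  thicken (base XP) m `<=` ball_graph n.
Proof.
move=> mn p [_ [g gP <-]] /(inf_lt (polygonal_nonempty _ _))[l gl lm].
have gb := polygonal_coset_ball gP gl.
have [v [w [t [vw t01 pE]]]] := svalP p.
have [x [y [xy [xE yE] px]]] : exists x y, [/\ cell S x y,
    (v = x \/ v = y) /\ (w = x \/ w = y) & 0 < sval p x].
  have [t1|t1] := ltP t 1.
    exists v, w; split=> //; first by split; [left|right].
    rewrite pE /edge_point eqxx.
    by case: (v == w); rewrite /= mulr1 ?mulr1 ?mulr0; lra.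
  exists w, v; split=> //.
  - by case: vw => [->|/adjacent_sym]; [left|right].
  - by split; [right|left].
  - rewrite pE /edge_point eqxx eq_sym.
    by case: (v == w); rewrite /= mulr1 ?mulr1 ?mulr0; lra.
have [k xk kl] := gb _ px.
have kn : (k < n)%N.
  rewrite -(ltr_nat R); apply: (@le_lt_trans _ _ (l + 1)).
    by apply: le_trans kl _; lra.
  by apply: lt_le_trans mn; lra.
have yn := coset_ball_le kn (coset_ball_cell xk xy).
have xn := coset_ball_le (ltnW kn) xk.
by exists v, w; split=> //; [case: xE|case: yE| exists t] => // ->.
Qed.

Lemma ball_graph_subgraph n : subgraph (ball_graph n).
Proof.
exists [set e | [/\ coset_ball n e.1, coset_ball n e.2 & cell S e.1 e.2]].
split=> [e []//|]; apply/seteqP; split=> p.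
  by move=> [v [w [vn wn vw vwp]]]; exists (v, w).
by move=> [[v w] [vn wn vw] vwp]; exists v, w.
Qed.

Lemma ball_graph_nonempty n : ball_graph n !=set0.
Proof.
exists (vertex R genS 1%g), 1%g, 1%g.
have n1 : coset_ball n 1%g by apply: (@coset_ball_le 0) => //=; apply: gpred1.
by split=> //; [left|exact: closed_cell_l].
Qed.

Lemma ball_graph_invariant n : Defs.invariant P (ball_graph n).
Proof.
move=> g p gP [v [w [vn wn vw vwp]]]; exists (g * v)%g, (g * w)%g.
by split; [exact: coset_ball_mull|exact: coset_ball_mull|exact: cell_mull|
  exact: translate_closed_cell].
Qed.

Lemma ball_graph_compact n : compact [set: orbit_space P (ball_graph n)].
Proof.
have [L LP] := coset_ball_finite n.
(* [C e] is empty when [e] is not a cell of the ball, so that the finite union over all pairs in the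
   list stays inside [ball_graph n]. *)
pose C (e : G * G) : set X := [set p | [/\ coset_ball n e.1, coset_ball n e.2,
  cell S e.1 e.2 & closed_cell e.1 e.2 p]].
pose K := \big[setU/set0]_(e <- [seq (v, w) | v <- L, w <- neighbors L]) C e.
have KE : K = \bigcup_(e in [set` [seq (v, w) | v <- L, w <- neighbors L]]) C e.
  by rewrite bigcup_seq.
apply: (@orbit_space_compact _ _ _ _ _ _ K).
- by rewrite KE => p [[v w] _ [vn wn vw vwp]]; exists v, w.
- apply: bigsetU_compact => -[v w] _.
  have [[vn wn vw]|nC] :=
      pselect [/\ coset_ball n v, coset_ball n w & cell S v w].
    rewrite (_ : C (v, w) = closed_cell v w); first exact: closed_cell_compact.
    by apply/seteqP; split=> p; [case|].
  rewrite (_ : C (v, w) = set0); first exact: compact0.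
  by apply/seteqP; split=> p // [vn wn vw _]; apply: nC.
- move=> p [v [w [vn wn vw vwp]]]; have [g gP gL] := LP _ vn; exists g => //.
  rewrite KE; exists (g * v, g * w)%g.
    apply/allpairsP; exists (g * v, g * w)%g; split=> //=.
    by apply: neighborsP gL _; apply: cell_mull.
  by split; [exact: coset_ball_mull|exact: coset_ball_mull|exact: cell_mull|
    exact: translate_closed_cell].
Qed.

(** A vertex outside [P] is joined by an edge to one of smaller level, so induction on the level
    descends to [P] without leaving the graph. *)
Lemma ball_graph_to_base n p : ball_graph n p ->
  exists2 g, g \in P & connected_component (ball_graph n) p (vertex R genS g).
Proof.
have cellP v w p1 p2 : coset_ball n v -> coset_ball n w -> cell S v w ->
    closed_cell v w p1 -> closed_cell v w p2 ->
    connected_component (ball_graph n) p1 p2.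
  move=> vn wn vw h1; apply: connected_component_max => //.
    exact: ball_graph_cell.
  exact: closed_cell_connected.
have vertexP k v : (k <= n)%N -> coset_ball k v ->
    exists2 g, g \in P &
      connected_component (ball_graph n) (vertex R genS v) (vertex R genS g).
  elim: k v => [|k IH] v kn vk.
    exists v => //; apply: (cellP v v); try exact: coset_ball_le vk.
    - by left.
    - exact: closed_cell_l.
    - exact: closed_cell_l.
  case: vk => [|[u uk uv]]; first by apply: IH; exact: ltnW.
  have [g gP ug] := IH _ (ltnW kn) uk; exists g => //.
  apply: connected_component_trans ug.
  have uv' : cell S u v by right.
  apply: (cellP u v) => //.
  - exact: coset_ball_le (ltnW kn) _ uk.
  - exact: coset_ball_le kn _ (coset_ball_cell uk uv').
  - exact: closed_cell_r.
  - exact: closed_cell_l.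
move=> [v [w [vn wn vw vwp]]]; have [g gP vg] := vertexP n v (leqnn n) vn.
exists g => //; apply: connected_component_trans vg.
by apply: (cellP v w) => //; exact: closed_cell_l.
Qed.

(** It suffices to join [x] in [A] to each [g] in [P]. A connected set [W] joins [x] to some [h] in
    [P]; its translate by [g * h^-1] joins a point of [A] to [g], and [A] joins that point to
    [x]. *)
Lemma ball_graph_connected n A : A !=set0 -> connected A ->
  Defs.invariant P A -> A `<=` ball_graph n -> connected (ball_graph n).
Proof.
move=> [x Ax] Ac Ai An.
have toP g : g \in P -> connected_component (ball_graph n) x (vertex R genS g).
  move=> gP; have [h hP [W [Wx WB Wc Wh]]] := ball_graph_to_base (An _ Ax).
  have gh : (g * h^-1)%g \in P by rewrite gpredM// gpredV.
  apply: (@connected_component_trans _ _ (translate (g * h^-1)%g x)).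
    by apply: (connected_component_max Ax An Ac); exact: Ai.
  exists (translate (g * h^-1)%g @` W).
    split; [by exists x| |exact: translate_connected].
    by move=> _ [y Wy <-]; apply: ball_graph_invariant => //; apply: WB.
  by exists (vertex R genS h); rewrite // translate_vertex mulgVK.
suff -> : ball_graph n = connected_component (ball_graph n) x.
  exact: component_connected.
apply/seteqP; split; last exact: connected_component_sub.
move=> p /ball_graph_to_base[g gP pg].
apply: connected_component_trans (toP g gP) _.
exact: connected_component_sym.
Qed.

Lemma cocompact_exhaust A (m : R) : cocompact_subgraph P A ->
  exists2 B, cocompact_subgraph P B & thicken (base XP) m `<=` B.
Proof.
move=> [_ A0 Ac Ai /(cocompact_thicken (P := P))[k Ak]].
(* The radius is large enough for the ball graph to contain the [m]-neighbourhood of the base and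
   also [A], which makes it connected. *)
pose M := Num.max m k%:R + 2; pose n := Num.bound M.
have Mn : M <= n%:R.
  apply/ltW/archi_boundP; rewrite addr_ge0// le_max ler0n orbT//.
exists (ball_graph n); last first.
  by apply: thicken_ball_graph; apply: le_trans Mn; rewrite lerD2r le_max lexx.
split; [exact: ball_graph_subgraph|exact: ball_graph_nonempty| |
  exact: ball_graph_invariant|exact: ball_graph_compact].
apply: (ball_graph_connected A0 Ac Ai); apply: subset_trans Ak _.
apply: thicken_ball_graph; apply: le_trans Mn.
by rewrite lerD2r le_max lexx orbT.
Qed.

End Exhaustion.

Lemma sval_inj (T : Type) (Q : T -> Prop) : injective (@proj1_sig T Q).
Proof. by move=> [x hx] [y hy] /=; apply: eq_exist. Qed.

(** * Coends and threads of the Cayley pair *)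

Section CoendThreads.
Context {R : realType} {G : groupType} {S : seq G} {genS : generating S}.
Context {P : groupClosed G}.
Notation X := (cayley R genS).
Notation XP := (cayley_pair R genS P).
Implicit Types (A B K : set X).

Lemma component_hull_component B K x : K x ->
  K `<=` connected_component (~` B) x ->
  component_hull B K = connected_component (~` B) x.
Proof.
move=> Kx Kc; apply/seteqP; split=> y; last by exists x.
by move=> [z /Kc xz zy]; apply: connected_component_trans zy.
Qed.

Lemma component_eq B K x :
  (exists2 y, (~` B) y & K = connected_component (~` B) y) ->
  K x -> K = connected_component (~` B) x.
Proof. by move=> [y _ ->]; apply: same_connected_component. Qed.

Lemma coend_component_mem B K : coend_component P B K -> exists x, K x.
Proof.
by move=> [[x Bx ->] _]; exists x; apply: connected_component_refl.
Qed.

(** Otherwise [K] would lie in the [m]-neighbourhood of [P], hence in a cocompact subgraph, which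
    differs from [B] since [K] avoids [B]. *)
Lemma coend_component_deep B K (m : R) : cocompact_subgraph P B ->
  coend_component P B K -> exists2 x, K x & @away R XP m x.
Proof.
move=> hB hK; have [[x Bx KE] nK] := hK; apply: contrapT => Km.
have Kx : K x by rewrite KE; apply: connected_component_refl.
have [C hC mC] := cocompact_exhaust m hB; have KC : K `<=` C.
  move=> y Ky; apply: mC; apply: contrapT => ym.
  by apply: Km; exists y.
apply: nK; exists C; split=> // CB; apply: Bx; rewrite -CB; exact: KC.
Qed.

Lemma deep_coend_component B K :
  (exists2 x, (~` B) x & K = connected_component (~` B) x) ->
  (forall m, exists2 x, K x & @away R XP m x) -> coend_component P B K.
Proof.
move=> KB Kdeep; split=> // -[C [[_ _ _ _ cC] _ KC]].
have [n Cn] := cocompact_thicken cC.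
by have [x /KC /Cn] := Kdeep n%:R.
Qed.

Lemma cocompact_directed A B :
  cocompact_subgraph P A -> cocompact_subgraph P B ->
  exists C, [/\ cocompact_subgraph P C, A `<=` C & B `<=` C].
Proof.
move=> hA [_ _ _ _ /(cocompact_thicken (P := P))[m Bm]].
have [_ _ _ _ /(cocompact_thicken (P := P))[n An]] := hA.
have [C hC mnC] := cocompact_exhaust (Num.max m%:R n%:R) hA; exists C.
by split=> // x; [move=> /An|move=> /Bm]; move=> [c Cc cx]; apply: mnC;
  exists c => //; apply: lt_le_trans cx _; rewrite le_max lexx ?orbT.
Qed.

(* Two points at distance at most k are joined by a path that stays within
   distance k + 1 of them, hence avoids B. *)
Lemma coarse_joined_component B (n k : R) (x y : X) : 0 <= k ->
  B `<=` thicken (base XP) n ->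
  coarse_joined (@away R XP (n + k + 1)) k x y ->
  connected_component (~` B) x y.
Proof.
move=> k0 Bn; have aB (a z : X) : @away R XP (n + k + 1) a ->
    mdist a z < k + 1 -> (~` B) z.
  move=> /awayP Za az /Bn[c Cc cz]; have := Za _ Cc.
  have := metric_triangle c z a; rewrite (metric_sym z a); lra.
apply: (@coarse_joined_ind R XP _ _ (connected_component (~` B))).
- move=> a /aB Za; apply/connected_component_refl/Za.
  by rewrite mdistxx ltr_wpDl.
- by move=> a b c; apply: connected_component_trans.
- move=> a b /aB Za _ ab.
  have [|W [Wc Wa Wb WP]] := @close_connected _ _ _ _ a b (k + 1).
    by apply: le_lt_trans ab _; rewrite ltrDl.
  by apply: (connected_component_max Wa _ Wc Wb) => z /WP /Za.
Qed.

Definition coend_set (x : coends R genS P) B (hB : cocompact_subgraph P B) :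
  set X := sval (sval x (exist _ B hB)).

Lemma coend_setP (x : coends R genS P) B (hB : cocompact_subgraph P B) :
  coend_component P B (coend_set x hB).
Proof. exact: (svalP (sval x (exist _ B hB))). Qed.

Lemma coend_set_connected (x : coends R genS P) B
    (hB : cocompact_subgraph P B) :
  connected (coend_set x hB) /\ coend_set x hB `<=` ~` B.
Proof.
have [[y By ->] _] := coend_setP x hB; split.
  exact: component_connected.
exact: connected_component_sub.
Qed.

Lemma coend_set_sub (x : coends R genS P) B C (hB : cocompact_subgraph P B)
    (hC : cocompact_subgraph P C) : B `<=` C ->
  coend_set x hC `<=` coend_set x hB.
Proof.
move=> BC y Cy.
have /(congr1 sval) := svalP x (exist _ B hB) (exist _ C hC) BC.
rewrite /coend_set /= => <-; exists y => //; apply: connected_component_refl.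
by move=> /BC; apply: (coend_set_connected x hC).2.
Qed.

Definition coend_tracks s (x : coends R genS P) (A : ends_at XP s) : Prop :=
  forall B (hB : cocompact_subgraph P B) (mu : {nonneg R}),
    thicken (base XP) mu%:num `<=` B -> coend_set x hB `<=` thread A mu.

Context (cocompact : exists A : set X, cocompact_subgraph P A).

(** The seeds are the components chosen by [x] for subgraphs [B mu] that contain the
    [mu]-neighbourhoods of [P]. They are connected, unbounded because they reach arbitrarily far
    from [P], and any two meet in the component chosen for a common larger subgraph. *)
Lemma coend_thread (s : {posnum R}) (x : coends R genS P) :
  exists A : ends_at XP s, coend_tracks x A.
Proof.
have [A0 hA0] := cocompact.
have /choice[B BP] (mu : {nonneg R}) : exists B : {B | cocompact_subgraph P B},
    thicken (base XP) mu%:num `<=` sval B.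
  by have [B hB muB] := cocompact_exhaust mu%:num hA0; exists (exist _ B hB).
have coarse C (hC : cocompact_subgraph P C) (mu : {nonneg R}) y z :
    thicken (base XP) mu%:num `<=` C -> coend_set x hC y -> coend_set x hC z ->
    coarse_joined (@away R XP mu%:num) s%:num y z.
  move=> muC; have [Kc KC] := coend_set_connected x hC.
  apply: (connected_coarse_joined (X := XP) Kc) => // w /KC.
  by apply: contra_not => /muC.
have meet C D (hC : cocompact_subgraph P C) (hD : cocompact_subgraph P D) :
    exists2 y, coend_set x hC y & coend_set x hD y.
  have [E [hE CE DE]] := cocompact_directed hC hD.
  have [y Ey] := coend_component_mem (coend_setP x hE).
  by exists y; apply: coend_set_sub Ey.
have [mu|mu y z|mu mu' mumu|A WA] := @thread_of_seeds _ XP s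
    (fun mu => coend_set x (svalP (B mu))).
- move=> Kb; have [c Cc] := base_nonempty XP.
  have [m Km] := bounded_thicken Cc Kb.
  have [y /Km yKm] := coend_component_deep m%:num (svalP (B mu))
    (coend_setP x (svalP (B mu))).
  exact.
- exact: coarse.
- have [y y1 y2] := meet _ _ (svalP (B mu')) (svalP (B mu)).
  by exists y, y; split=> //; exact: (coarse _ _ _ _ _ (BP mu) y2 y2).
exists A => C hC mu muC y Cy.
have [z Cz Bz] := meet _ _ hC (svalP (B mu)).
apply/(thread_joined _ (WA _ _ Bz)); exact: coarse muC Cz Cy.
Qed.

Lemma coend_tracks_inj s s' (x x' : coends R genS P) (A : ends_at XP s)
    (A' : ends_at XP s') :
  coend_tracks x A -> coend_tracks x' A' -> fend A = fend A' -> x = x'.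
Proof.
move=> xA xA' /fend_eqP[k [_ _ AA]]; have [A0 hA0] := cocompact.
suff KE B (hB : cocompact_subgraph P B) : coend_set x hB = coend_set x' hB.
  apply: sval_inj; apply: functional_extensionality_dep => -[B hB].
  apply: sval_inj; exact: KE.
have [_ _ _ _ /(cocompact_thicken (P := P))[n Bn]] := hB.
have m0 : 0 <= n%:R + k%:num + 1 :> R by rewrite !addr_ge0.
(* At radius [n + k + 1], a [k]-chain between the two threads can be filled by connected sets
   avoiding [B], so both coends choose the same component of the complement of [B]. *)
have [C hC mC] := cocompact_exhaust (n%:R + k%:num + 1) hA0.
have [D [hD CD BD]] := cocompact_directed hC hB.
have mD := subset_trans mC CD.
have [y Dy] := coend_component_mem (coend_setP x hD).
have [z Dz] := coend_component_mem (coend_setP x' hD).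
have := AA (NngNum m0) y z (xA _ hD (NngNum m0) mD _ Dy)
  (xA' _ hD (NngNum m0) mD _ Dz).
move=> /(coarse_joined_component (ge0 k) Bn) yz.
rewrite (component_eq (coend_setP x hB).1 (coend_set_sub hB BD Dy)).
rewrite (component_eq (coend_setP x' hB).1 (coend_set_sub hB BD Dz)).
exact: same_connected_component.
Qed.

(** Far enough from [P], the thread lies in a single component of the complement of [B]. These
    components are compatible since any two levels of a thread meet, and they are admissible since
    the thread goes arbitrarily far from [P]. *)
Lemma thread_coend s (A : ends_at XP s) : exists x : coends R genS P,
  forall B (hB : cocompact_subgraph P B), exists mu : {nonneg R},
    thread A mu `<=` coend_set x hB.
Proof.
have /choice[mu muP] (B : {B | cocompact_subgraph P B}) :
    exists mu : {nonneg R}, forall y z, thread A mu y -> thread A mu z ->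
      connected_component (~` sval B) y z.
  have [_ _ _ _ /(cocompact_thicken (P := P))[n Bn]] := svalP B.
  have m0 : 0 <= n%:R + s%:num + 1 :> R by rewrite !addr_ge0.
  exists (NngNum m0) => y z Ay /(thread_joined _ Ay).
  exact: coarse_joined_component (ge0 s) Bn.
pose T b := component_hull (sval b) (thread A (mu b)).
have TE b y : thread A (mu b) y -> T b = connected_component (~` sval b) y.
  by move=> Ay; apply: component_hull_component => // z; apply: muP.
have TA b : thread A (mu b) `<=` T b.
  by move=> y Ay; rewrite (TE _ _ Ay); apply: muP.
have max_thread (m m' : {nonneg R}) : exists2 y, thread A m y & thread A m' y.
  have M0 : 0 <= Num.max m%:num m'%:num by rewrite le_max ge0.
  have [y Ay] := thread_nonempty A (NngNum M0).
  by exists y; apply: thread_le Ay; rewrite /= le_max lexx ?orbT.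
have TP b : coend_component P (sval b) (T b).
  apply: deep_coend_component => [|m].
    have [y Ay] := thread_nonempty A (mu b); exists y; last exact: TE.
    by have /connected_component_sub := muP _ _ _ Ay Ay.
  have m0 : 0 <= `|m| by [].
  have [y y1 y2] := max_thread (mu b) (NngNum m0).
  exists y; first exact: TA.
  by apply: away_le (thread_away y2); exact: ler_norm.
have TC b c (bc : sval b `<=` sval c) :
    exist (coend_component P (sval b)) (component_hull (sval b) (T c))
      (component_hull_coend bc
        (svalP (exist (coend_component P (sval c)) (T c) (TP c)))) =
    exist _ (T b) (TP b).
  apply: eq_exist; have [y y1 y2] := max_thread (mu b) (mu c).
  rewrite (TE _ _ y1); apply: component_hull_component; first exact: TA.
  rewrite (TE _ _ y2); apply: connected_component_max.
  - apply: connected_component_refl.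
    by have /connected_component_sub := muP _ _ _ y2 y2.
  - by apply: subset_trans (@connected_component_sub _ _ _) _; apply: subsetC.
  - exact: component_connected.
exists (exist _ (fun b => exist _ (T b) (TP b)) TC) => B hB.
by exists (mu (exist _ B hB)); apply: TA.
Qed.

Definition end_of_coend (x : coends R genS P) : filtered_ends XP :=
  fend (sval (cid (coend_thread 1%:pos x))).

(** For surjectivity, the thread [A1] built from the coend of [A] has a point in common with [A] at
    each level. *)
Lemma end_of_coend_bij : bijective end_of_coend.
Proof.
rewrite -setTT_bijective; split=> // [x y _ _|z _]; rewrite /end_of_coend.
  case: cid => A xA; case: cid => B yB /=; exact: coend_tracks_inj.
have [s [A ->]] := fendP z; have [x xA] := thread_coend A; exists x => //.
case: cid => A1 xA1 /=; apply: (@fend_eq _ _ s%:num) => mu.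
have [A0 hA0] := cocompact.
have [B hB muB] := cocompact_exhaust mu%:num hA0; have [m AB] := xA B hB.
have M0 : 0 <= Num.max m%:num mu%:num by rewrite le_max ge0.
have [y Ay] := thread_nonempty A (NngNum M0).
have ym : thread A m y by apply: thread_le Ay; rewrite /= le_max lexx.
have ymu : thread A mu y by apply: thread_le Ay; rewrite /= le_max lexx orbT.
exists y, y; split=> //; first by apply: (xA1 _ hB _ muB); apply: AB.
exact: coarse_joined_refl (thread_away ymu).
Qed.

End CoendThreads.

(** * The functor of filtered ends and its four properties *)

Theorem theorem5p2 (R : realType) :
  exists E : forall X Y : qpmet R,
      qpmor X Y -> filtered_ends X -> filtered_ends Y,
  [/\ [/\ forall (X Y : qpmet R) (f : qpmor X Y), induced_by f (E X Y f),
          forall X : qpmet R, E X X (qpid X) = idfun &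
          forall (X Y Z : qpmet R) (g : qpmor Y Z) (f : qpmor X Y),
            E X Z (qpcomp g f) = E Y Z g \o E X Y f],
      forall (X : qpmet R) (f : qpmor X X),
        (exists2 r : R, 0 <= r & forall x, mdist (f x) x <= r) ->
        E X X f = idfun,
      forall (X Y : qpmet R) (f : X -> Y),
        quasi_isometry f -> (hdist (f @` base X) (base Y) < +oo)%E ->
        exists2 m : qpmor X Y, qpfun m = f & bijective (E X Y m),
      exists Phi : forall X : qpmet R,
          proper_geodesic_compact X -> filtered_ends X -> ends X,
        [/\ forall (X : qpmet R) (hX : proper_geodesic_compact X),
              bijective (Phi X hX),
            forall (X : qpmet R) (hX : proper_geodesic_compact X)
                (s : {posnum R}) (A : ends_at X s) (r : proper_ray X),
              Phi X hX (fend A) = end_of r <->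
              forall mu : {nonneg R}, exists N : nat,
                r @` `[N%:R, +oo[ `<=` thread A mu &
            forall (X Y : qpmet R) (hX : proper_geodesic_compact X)
                (hY : proper_geodesic_compact Y) (f : qpmor X Y)
                (x : filtered_ends X) (r : proper_ray X) (r' : proper_ray Y),
              (exists K : R, forall t, 0 <= t -> mdist (f (r t)) (r' t) <= K) ->
              Phi X hX x = end_of r -> Phi Y hY (E X Y f x) = end_of r'] &
      forall (G : groupType) (S : seq G) (genS : generating S)
          (P : groupClosed G),
        (exists A : set (cayley R genS), cocompact_subgraph P A) ->
        [set: filtered_ends (cayley_pair R genS P)] #=
          [set: coends R genS P]].
Proof.
exists (@end_map R); split.
- split; [exact: end_map_induced| |exact: end_map_comp].
  by move=> X; apply: end_map_near_id; exists 0 => // x; rewrite mdistxx.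
- exact: end_map_near_id.
- exact: quasi_isometry_end_map.
- exists (@end_limit R); split=> [X hX|X hX|].
  + exact: end_limit_bij.
  + exact: end_limitP.
  + by move=> X Y hX hY f x r r' [K]; apply: end_limit_natural.
- move=> G S genS P hA.
  have [_ inj surj] : set_bij setT setT (end_of_coend hA).
    by rewrite setTT_bijective; exact: end_of_coend_bij.
  rewrite (_ : [set: filtered_ends _] = end_of_coend hA @` setT).
    exact: inj_card_eq.
  by apply/seteqP; split=> // z; apply: surj.
Qed.
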